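(* Let $s\ge1$ and $f\in\ell(\mathbb{Z}^s)$. The following statements are equivalent. (1) $\operatorname{rank} H(f)<\infty$. (2) There exists an ideal $I\subset\Pi$ with a Gröbner basis $G$ such that $$\mathcal{S}(f) = \bigcap_{q\in I}\ker(\cdot,q) = \bigcap_{g\in G}\ker(\cdot,g)\qquad\text{and}\qquad \operatorname{rank} H(f) = \dim\Pi/I.$$ (3) There exist a finite set $\Omega\subset(\mathbb{R}+i\mathbb{T})^s$ and shift invariant subspaces $\mathcal{Q}_\omega\subset\Pi$, $\omega\in\Omega$, such that $$\mathcal{S}(f) = \bigoplus_{\omega\in\Omega}\mathcal{Q}_\omega\, e^{\omega^T\cdot}\qquad\text{and}\qquad \operatorname{rank} H(f) = \sum_{\omega\in\Omega}\dim\mathcal{Q}_\omega.$$ (4) There exist a finite set $\Omega\subset(\mathbb{R}+i\mathbb{T})^s$ and shift invariant subspaces $\mathcal{Q}_\omega\subset\Pi$, $\omega\in\Omega$, such that $f$ is of the form $$f(x) = \sum_{\omega\in\Omega} f_\omega(x)\, e^{\omega^T x},\quad x\in\mathbb{Z}^s,\qquad f_\omega\in\mathcal{Q}_\omega,\ \omega\in\Omega.$$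
   Context: $\mathbb{N}_0 = \{0,1,2,\dots\}$; $\ell(\mathbb{Z}^s)$ is the complex vector space of all functions (sequences) $f:\mathbb{Z}^s\to\mathbb{C}$; $\Pi=\mathbb{C}[z_1,\dots,z_s]$ is the ring of polynomials in $s$ variables and $\Lambda=\mathbb{C}[z_1^{\pm1},\dots,z_s^{\pm1}]\supset\Pi$ the ring of Laurent polynomials; $\mathbb{T}=\mathbb{R}/(2\pi\mathbb{Z})$. For $\omega\in(\mathbb{R}+i\mathbb{T})^s$ and $x\in\mathbb{Z}^s$ the number $e^{\omega^Tx}$ is well defined. For finite sets $A,B\subset\mathbb{Z}^s$ the Hankel matrix of $f$ is $H_{A,B}(f) = \big(f(\alpha+\beta)\big)_{\alpha\in A,\ \beta\in B}\in\mathbb{C}^{A\times B}$, and the rank of the Hankel operator $H(f)$ is $\operatorname{rank} H(f) = \sup\{\operatorname{rank} H_{A,B}(f) : A,B\subset\mathbb{Z}^s\text{ finite}\}\in\mathbb{N}_0\cup\{\infty\}$. For $\alpha\in\mathbb{Z}^s$ the translation operator is $\tau^\alpha f = f(\cdot+\alpha)$, and $\mathcal{S}(f)=\operatorname{span}\{\tau^\alpha f:\alpha\in\mathbb{Z}^s\}$ is the shift invariant space generated by $f$. The bilinear map $(\cdot,\cdot):\ell(\mathbb{Z}^s)\times\Lambda\to\ell(\mathbb{Z}^s)$ is given by $(c,q)=q(\tau)c=\sum_{\beta}q_\beta\,\tau^\beta c$ for $q(z)=\sum_\beta q_\beta z^\beta$, and $\ker(\cdot,q)=\{c\in\ell(\mathbb{Z}^s):(c,q)=0\}$.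 A subspace $\mathcal{Q}\subset\Pi$ is shift invariant if $q\in\mathcal{Q}$ implies $\tau^\alpha q=q(\cdot+\alpha)\in\mathcal{Q}$ for all $\alpha\in\mathbb{N}_0^s$. The space $\mathcal{Q}_\omega\,e^{\omega^T\cdot}$ is the subspace of $\ell(\mathbb{Z}^s)$ of all sequences $x\mapsto q(x)e^{\omega^Tx}$, $x\in\mathbb{Z}^s$, with $q\in\mathcal{Q}_\omega$. A Gröbner basis is understood as a finite one, with respect to some monomial order. Dimensions take values in $\mathbb{N}_0\cup\{\infty\}$. *)

(* Defs.v *)
From HB Require Import structures.
From mathcomp Require Import all_boot all_order all_algebra finmap.
(* mpoly has to be imported before mathcomp-analysis: in the other order the
   precedence levels of some of their notations clash. *)
From mathcomp Require Import mpoly.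
From mathcomp Require Import all_classical all_reals all_analysis.
From mathcomp Require Import complex.

Set Implicit Arguments.
Unset Strict Implicit.
Unset Printing Implicit Defensive.

Import Order.TTheory GRing.Theory Num.Theory.

Local Open Scope classical_set_scope.
Local Open Scope ring_scope.

Section LinearAlgebra.
Variables (K : nzRingType) (V : lmodType K).

Definition is_subspace (U : set V) : Prop :=
  U 0 /\ forall (a : K) (u v : V), U u -> U v -> U (a *: u + v).

Definition lspan (X : set V) : set V :=
  [set v | exists (n : nat) (b : 'I_n -> V) (c : 'I_n -> K),
     (forall i, X (b i)) /\ v = \sum_i c i *: b i].

(* The classes of the b i form a basis of the quotient space U / W. *)
Definition basis_mod (U W : set V) (n : nat) (b : 'I_n -> V) : Prop :=
  [/\ forall i, U (b i),
      forall c : 'I_n -> K, W (\sum_i c i *: b i) -> forall i, c i = 0 &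
      forall u, U u -> exists c : 'I_n -> K, W (u - \sum_i c i *: b i)].

(* dim U / W: the size of any finite basis, +oo when there is none
   (the infimum of the empty set). *)
Definition edim_quot (R : realType) (U W : set V) : \bar R :=
  ereal_inf [set n%:R%:E | n in
    [set n : nat | exists b : 'I_n -> V, basis_mod U W b]].

Definition edim (R : realType) (U : set V) : \bar R :=
  edim_quot R U [set 0].

Definition is_direct_sum (I : choiceType) (J : {fset I}) (U : I -> set V)
    (S : set V) : Prop :=
  S = [set v | exists2 u : I -> V,
         (forall j, j \in J -> U j (u j)) & v = \sum_(j <- J) u j] /\
  forall u : I -> V, (forall j, j \in J -> U j (u j)) ->
    \sum_(j <- J) u j = 0 -> forall j, j \in J -> u j = 0.

End LinearAlgebra.

Section Ideals.
Variable A : comNzRingType.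

(* Unlike [idealr_closed], this allows the improper ideal. *)
Definition is_ideal (I : set A) : Prop :=
  [/\ I 0, forall p q, I p -> I q -> I (p + q)
    & forall a p, I p -> I (a * p)].

Definition ideal_gen (X : set A) : set A :=
  [set p | forall I, is_ideal I -> X `<=` I -> I p].

End Ideals.

Section Groebner.
Variables (K : fieldType) (s : nat).

Definition monomial_order (le : rel 'X_{1..s}) : Prop :=
  [/\ [/\ reflexive le, antisymmetric le, transitive le & total le],
      forall m, le 0%MM m
    & forall m1 m2 m, le m1 m2 -> le (m1 + m)%MM (m2 + m)%MM].

Definition is_leading_monomial (le : rel 'X_{1..s}) (p : {mpoly K[s]})
    (m : 'X_{1..s}) : Prop :=
  m \in msupp p /\ forall m', m' \in msupp p -> le m' m.

Definition leading_terms (le : rel 'X_{1..s}) (P : set {mpoly K[s]}) :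
    set {mpoly K[s]} :=
  [set t | exists p m,
     [/\ P p, is_leading_monomial le p m & t = p@_m *: 'X_[m]]].

Definition is_groebner_basis (I : set {mpoly K[s]}) (G : {fset {mpoly K[s]}}) :
    Prop :=
  exists le : rel 'X_{1..s},
    [/\ monomial_order le, [set` G] `<=` I
      & ideal_gen (leading_terms le [set` G]) = ideal_gen (leading_terms le I)].

End Groebner.

Section Torus.
Variable R : realType.

Definition eq_mod2pi (x y : R) : bool :=
  `[< exists k : int, x - y = 2 * pi * k%:~R >].

Lemma eq_mod2pi_refl : reflexive eq_mod2pi.
Proof. by move=> x; apply/asboolP; exists 0; rewrite subrr mulr0. Qed.

Lemma eq_mod2pi_sym : ssrbool.symmetric eq_mod2pi.
Proof.
move=> x y; apply/asboolP/asboolP => -[k e]; exists (- k);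
  by rewrite mulrNz mulrN -e opprB.
Qed.

Lemma eq_mod2pi_trans : transitive eq_mod2pi.
Proof.
move=> y x z /asboolP[k e] /asboolP[l e']; apply/asboolP; exists (k + l).
by rewrite intrD mulrDr -e -e' addrA subrK.
Qed.

Canonical eq_mod2pi_equiv :=
  EquivRel eq_mod2pi eq_mod2pi_refl eq_mod2pi_sym eq_mod2pi_trans.

Definition torus := {eq_quot eq_mod2pi_equiv}%qT.

HB.instance Definition _ := Choice.on torus.
HB.instance Definition _ := EqQuotient.on torus.

End Torus.

Section Sequences.
Variables (R : realType) (s : nat).

(* Sequences take values in R[i]^o rather than R[i]: the scalars of the
   canonical module structure of R[i] are those of R. *)
Local Notation seqs := ('rV[int]_s -> R[i]^o).
Local Notation poly := {mpoly R[i][s]}.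

Definition translate (a : 'rV[int]_s) (f : seqs) : seqs := fun x => f (x + a).

Definition shift_space (f : seqs) : set seqs :=
  lspan (range (fun a => translate a f)).

Definition hankel_mx (A B : {fset 'rV[int]_s}) (f : seqs) :
    'M[R[i]]_(size A, size B) :=
  \matrix_(i < size A, j < size B) f (nth 0 A i + nth 0 B j).

Definition hankel_rank (f : seqs) : \bar R :=
  ereal_sup (range (fun AB : {fset 'rV[int]_s} * {fset 'rV[int]_s} =>
    (\rank (hankel_mx AB.1 AB.2 f))%:R%:E)).

Definition mnm_vec (m : 'X_{1..s}) : 'rV[int]_s := \row_i (m i)%:Z.

(* (c, q) = q(tau) c, for q a polynomial. *)
Definition poly_shift (c : seqs) (q : poly) : seqs :=
  \sum_(m <- msupp q) q@_m *: translate (mnm_vec m) c.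

Definition shift_ker (q : poly) : set seqs := [set c | poly_shift c q = 0].

Definition translate_poly (a : 'X_{1..s}) (q : poly) : poly :=
  q \mPo [tuple 'X_i + ((a i)%:R : R[i])%:MP | i < s].

Definition shift_invariant_subspace (Q : set poly) : Prop :=
  is_subspace Q /\ forall (a : 'X_{1..s}) q, Q q -> Q (translate_poly a q).

Definition eval_int (q : poly) (x : 'rV[int]_s) : R[i] :=
  q.@[fun i => (x 0 i)%:~R].

(* (R + iT)^s; a component (a, t) stands for a + i t. *)
Definition freq := 'rV[(R * torus R)%type]_s.

(* exp (a^T x + i t^T x) for real vectors a, t *)
Definition exp_dot (a t : 'I_s -> R) (x : 'rV[int]_s) : R[i] :=
  (expR (\sum_i a i * (x 0 i)%:~R))%:C%C *
  (cos (\sum_i t i * (x 0 i)%:~R) +i* sin (\sum_i t i * (x 0 i)%:~R))%C.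

Definition exp_freq (w : freq) (x : 'rV[int]_s) : R[i] :=
  exp_dot (fun i => (w 0 i).1) (fun i => repr (w 0 i).2) x.

Definition exp_space (Q : set poly) (w : freq) : set seqs :=
  [set g | exists2 q, Q q & g = fun x => eval_int q x * exp_freq w x].

End Sequences.

Section WellDefined.
Variables (R : realType) (s : nat).

Lemma cos_sin_2pi (x : R) (k : int) :
  cos (x + 2 * pi * k%:~R) = cos x /\ sin (x + 2 * pi * k%:~R) = sin x.
Proof.
have H (n : nat) (y : R) :
    cos (y + 2 * pi * n%:R) = cos y /\ sin (y + 2 * pi * n%:R) = sin y.
  elim: n y => [|n IH] y; first by rewrite mulr0 addr0.
  have -> : y + 2 * pi * n.+1%:R = (y + 2 * pi * n%:R) + pi *+ 2.
    by rewrite -[n.+1]addn1 natrD mulrDr mulr1 addrA [2 * pi]mulr_natl.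
  by rewrite cosD2pi sinD2pi.
case: k => n; first exact: H.
have [hc hs] := H n.+1 (x + 2 * pi * (Negz n)%:~R).
by rewrite -hc -hs NegzE mulrNz mulrN subrK.
Qed.

(* The value of exp_freq does not depend on the chosen representatives. *)
Lemma exp_freqE (w : freq R s) (t : 'I_s -> R) (x : 'rV[int]_s) :
  (forall i, \pi_(torus R)%qT (t i) = (w 0 i).2) ->
  exp_freq w x = exp_dot (fun i => (w 0 i).1) t x.
Proof.
move=> ht; rewrite /exp_freq /exp_dot; congr (_ * _).
have /choice[k hk] : forall i, exists k : int,
    repr (w 0 i).2 - t i = 2 * pi * k%:~R.
  move=> i; apply/asboolP; rewrite -/(eq_mod2pi _ _).
  have := reprK (w 0 i).2; rewrite -{2}ht => /eqmodP; exact.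
have -> : \sum_i repr (w 0 i).2 * (x 0 i)%:~R =
    \sum_i t i * (x 0 i)%:~R + 2 * pi * (\sum_i k i * x 0 i)%:~R :> R.
  rewrite rmorph_sum mulr_sumr -big_split; apply: eq_bigr => i _ /=.
  by rewrite -[repr _](subrK (t i)) hk addrC mulrDl rmorphM /= mulrA addrC.
by have [-> ->] := cos_sin_2pi (\sum_i t i * (x 0 i)%:~R) (\sum_i k i * x 0 i).
Qed.

End WellDefined.

(* Main.v *)
Require Import Defs.
From HB Require Import structures.
From mathcomp Require Import all_boot all_order all_algebra finmap.
From mathcomp Require Import mpoly.
From mathcomp Require Import all_classical all_reals all_analysis.
From mathcomp Require Import complex.
From mathcomp Require Import ring.

(** The idea is that a Hankel operator of finite rank [r] factors. Choose row points
    [a i] and column points [b j] whose [r] by [r] section is invertible, with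
    inverse [N]; since no section has larger rank, the Schur complement of this
    section in every bordered section vanishes, which says
      f (x + y) = sum_(i, j) f (x + b j) * N j i * f (a i + y)    for all x, y
    ([hankel_border]). Translating the [a i] by some vector and the [b j] by its
    opposite does not change the section, so the [a i] may be taken in the positive
    orthant ([hankel_factor]). The identity gives everything about the space of
    translates S(f): the translates by the [a i] form a basis, and the values at
    the [b j] determine its elements. For the ideal I of the polynomials q with
    q(tau) f = 0 it shows that the monomials [z ^ a i] form a basis of the quotient
    by I, and that z^x is congruent modulo I to a combination of them for every
    lattice point x; a sequence killed by I therefore satisfies the same identity as
    f, and so it is a combination of the translates by the [b j]
    ([annihilator_kernel]). As I contains a univariate polynomial in each variable,
    finitely many leading monomials generate all of them, whence a finite Groebner
    basis; it generates I by division with remainder.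

    Conversely, let S(f) be the joint kernel of an ideal, a priori of infinite
    codimension. Such a kernel is closed under locally finite sums. If the rank
    of the Hankel operator were infinite, S(f) would contain nonzero sequences
    vanishing on any given finite set, and one could add up suitable ones to a
    sequence in S(f) growing faster than any finite combination of the translates
    of f ([kernel_space_finite_rank]).

    When the rank is finite, every translation is annihilated by a univariate
    polynomial on each element of S(f). By Bezout's identity f is then a sum of
    joint generalized eigensequences of the translations that lie in S(f)
    ([primary_decomposition]). The eigenvalues are nonzero, so after division by an
    exponential they become 1, all iterated differences vanish from some order on,
    and Newton's formula in each coordinate shows that what remains is a polynomial
    ([newton]). The coefficient space at a frequency w consists of all q such that
    q times the exponential lies in S(f). The sum over the frequencies is direct,
    since distinct frequencies have distinct eigenvalues, and the dimensions add up
    because a polynomial vanishing on the lattice is zero ([eval_int_eq0]).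

    Finally, sequences with f (x + y) = sum_t a_t(x) b_t(y) for a finite sum have
    finite rank, and they form an algebra containing the coordinates and the
    exponentials, hence all exponential polynomials ([separable_exp_poly]). *)

Set Implicit Arguments.
Unset Strict Implicit.
Unset Printing Implicit Defensive.

Import Order.TTheory GRing.Theory Num.Theory.

Local Open Scope classical_set_scope.
Local Open Scope ring_scope.

(** * Linear algebra modulo a subspace *)

Section LinearAlgebra.
Variables (K : fieldType) (V : lmodType K).
Implicit Types U W : set V.

Lemma exists_left_kernel m n (A : 'M[K]_(m, n)) :
  (n < m)%N -> exists2 v : 'rV_m, v != 0 & v *m A = 0.
Proof.
move=> ltnm; have : kermx A != 0.
  rewrite -mxrank_eq0 mxrank_ker subn_eq0 -ltnNge.
  exact: leq_ltn_trans (rank_leq_col A) ltnm.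
by case/rowV0Pn => v /sub_kermxP vA v0; exists v.
Qed.

Lemma subspaceD U u v : is_subspace U -> U u -> U v -> U (u + v).
Proof. by move=> [_ H] Uu Uv; rewrite -[u]scale1r; apply: H. Qed.

Lemma subspaceZ U a u : is_subspace U -> U u -> U (a *: u).
Proof. by move=> [U0 H] Uu; rewrite -[a *: u]addr0; apply: H. Qed.

Lemma subspace_sum U (I : Type) (r : seq I) (P : pred I) (F : I -> V) :
  is_subspace U -> (forall i, P i -> U (F i)) -> U (\sum_(i <- r | P i) F i).
Proof.
move=> sU UF; elim/big_rec: _ => [|i v Pi Uv]; first by case: sU.
by apply: subspaceD => //; apply: UF.
Qed.

Lemma subspace0 : is_subspace [set 0 : V].
Proof. by split=> // a u v -> ->; rewrite scaler0 addr0. Qed.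

(** Otherwise the matrix of coordinates of the [b' i] has more rows than columns,
    and an element of its left kernel is a relation between the [b' i]. *)
Lemma indep_leq_basis U W n m (b : 'I_n -> V) (b' : 'I_m -> V) :
  is_subspace W -> basis_mod U W b -> (forall i, U (b' i)) ->
  (forall c : 'I_m -> K, W (\sum_i c i *: b' i) -> forall i, c i = 0) ->
  (m <= n)%N.
Proof.
move=> sW [_ _ span] Ub' ind; rewrite leqNgt; apply/negP => ltnm.
have /choice[C HC] : forall i, exists c : 'I_n -> K,
    W (b' i - \sum_j c j *: b j) by move=> i; apply: span.
have [v /eqP v0 vC] := exists_left_kernel (\matrix_(i, j) C i j) ltnm.
apply: v0; apply/rowP => i; rewrite mxE; apply: ind i.
have -> : \sum_i v 0 i *: b' i = \sum_i v 0 i *: (b' i - \sum_j C i j *: b j).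
  under [RHS]eq_bigr do rewrite scalerBr; rewrite sumrB.
  suff -> : \sum_i v 0 i *: (\sum_j C i j *: b j) = 0 by rewrite subr0.
  under eq_bigr do rewrite scaler_sumr.
  rewrite exchange_big big1 //= => j _.
  under eq_bigr do rewrite scalerA; rewrite -scaler_suml.
  have /rowP/(_ j) := vC; rewrite !mxE.
  by under eq_bigr do rewrite mxE; move=> ->; rewrite scale0r.
by apply: subspace_sum => // i _; apply: subspaceZ.
Qed.

Lemma edim_quot_basis (R : realType) U W n (b : 'I_n -> V) :
  is_subspace W -> basis_mod U W b -> edim_quot R U W = n%:R%:E.
Proof.
move=> sW bU; rewrite /edim_quot.
suff -> : [set m | exists b' : 'I_m -> V, basis_mod U W b'] = [set n].
  by rewrite image_set1 ereal_inf1.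
apply/seteqP; split=> m /=; last by move=> ->; exists b.
move=> [b' b'U]; apply/eqP; rewrite eqn_leq.
have [[Ub ind _] [Ub' ind' _]] := (bU, b'U).
by rewrite (indep_leq_basis sW bU Ub' ind') (indep_leq_basis sW b'U Ub ind).
Qed.

(** A longest independent family in [U] is a basis; the length is bounded since
    [e] carries independent families to independent rows. *)
Lemma exists_basis U r (e : {linear V -> 'rV[K]_r}) :
  is_subspace U -> (forall u, U u -> e u = 0 -> u = 0) ->
  exists n (b : 'I_n -> V), basis_mod U [set 0] b.
Proof.
move=> sU inj.
pose P n := `[< exists b : 'I_n -> V, (forall i, U (b i)) /\
  forall c : 'I_n -> K, \sum_i c i *: b i = 0 -> forall i, c i = 0 >].
have exP : exists n, P n.
  by exists 0%N; apply/asboolP; exists (fun=> 0); split=> [[]|c _ []].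
have ubP n : P n -> (n <= r)%N.
  move=> /asboolP[b [Ub ind]]; rewrite leqNgt; apply/negP => ltrn.
  have [v /eqP v0 vC] := exists_left_kernel (\matrix_i e (b i)) ltrn.
  apply: v0; apply/rowP => i; rewrite mxE; apply: ind i; apply: inj.
    by apply: subspace_sum => // i _; apply: subspaceZ.
  rewrite -[RHS]vC mulmx_sum_row linear_sum; apply: eq_bigr => i _.
  by rewrite linearZ rowK.
case: (ex_maxnP exP ubP) => n /asboolP[b [Ub ind]] maxn.
exists n, b; split=> // u Uu; apply: contrapT => nspan.
suff /maxn : P n.+1 by rewrite ltnn.
apply/asboolP; exists (fun i => oapp b u (unlift ord0 i)); split.
  by move=> i; case: (unlift ord0 i) => [j|] /=; [apply: Ub|].
move=> c; rewrite big_ord_recl unlift_none /=.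
under eq_bigr do rewrite liftK /=.
have [c0|c0] := eqVneq (c ord0) 0.
  rewrite c0 scale0r add0r => /ind H i.
  by case: (unliftP ord0 i) => [j|] ->.
move=> /eqP; rewrite addr_eq0 => /eqP cu; case: nspan.
exists (fun i => - ((c ord0)^-1 * c (lift ord0 i))) => /=.
apply/eqP; rewrite subr_eq0; apply/eqP; apply: (scalerI c0).
rewrite cu scaler_sumr -sumrN; apply: eq_bigr => i _.
by rewrite scalerA mulrN mulrA divff // mul1r scaleNr.
Qed.

Lemma basis_mod_enum U (T : finType) (b : T -> V) :
  (forall t, U (b t)) ->
  (forall c : T -> K, \sum_t c t *: b t = 0 -> forall t, c t = 0) ->
  (forall u, U u -> exists c : T -> K, u = \sum_t c t *: b t) ->
  basis_mod U [set 0] (fun i : 'I_#|T| => b (enum_val i)).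
Proof.
have reindexT (c : 'I_#|T| -> K) :
    \sum_i c i *: b (enum_val i) = \sum_t c (enum_rank t) *: b t.
  rewrite (reindex enum_rank) /=; last first.
    by exists enum_val => i _; rewrite ?enum_rankK ?enum_valK.
  by apply: eq_bigr => t _; rewrite enum_rankK.
move=> Ub ind span; split=> //.
  by move=> c; rewrite reindexT => /ind H i; rewrite -(enum_valK i) H.
move=> u /span[c ->]; exists (fun i => c (enum_val i)); apply/eqP.
rewrite reindexT subr_eq0; apply/eqP; apply: eq_bigr => t _.
by rewrite enum_rankK.
Qed.

(** Bases of the summands assemble to a basis of a direct sum, indexed by the pairs
    of a summand and an element of its basis. *)
Lemma edim_direct_sum (R : realType) (J : choiceType) (Omega : {fset J})
    (U : J -> set V) S (n : J -> nat) (b : forall w, 'I_(n w) -> V) :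
  (forall w, is_subspace (U w)) -> (forall w, basis_mod (U w) [set 0] (b w)) ->
  is_direct_sum Omega U S -> edim R S = (\sum_(w <- Omega) edim R (U w))%E.
Proof.
move=> sU bU [SE ind].
pose T := {w : Omega & 'I_(n (fsval w))}.
pose B (t : T) : V := b (fsval (tag t)) (tagged t).
have BU t : U (fsval (tag t)) (B t).
  by have [H _ _] := bU (fsval (tag t)); apply: H.
have sumT (w : Omega) (F : T -> V) :
    \sum_(t | tag t == w) F t =
    \sum_k F (Tagged (fun w : Omega => 'I_(n (fsval w))) (i := w) k).
  transitivity (\sum_(w' | w' == w)
    \sum_k F (Tagged (fun w : Omega => 'I_(n (fsval w))) (i := w') k));
    last exact: big_pred1_eq.
  by rewrite sig_big_dep /=; apply: eq_big => [t|[]//]; rewrite andbT.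
have sumS (F : T -> V) : \sum_(w <- Omega) \sum_(t | fsval (tag t) == w) F t = \sum_t F t.
  by rewrite big_seq_fsetE /= [RHS](partition_big tag xpredT).
have bS : basis_mod S [set 0] (fun i : 'I_#|{: T}| => B (enum_val i)).
  apply: basis_mod_enum => [t|c c0 t|u].
  - rewrite SE; exists (fun w => if w == fsval (tag t) then B t else 0).
      by move=> w _; case: eqP => [->|_] //; case: (sU w).
    rewrite (big_fsetD1 (fsval (tag t))) ?fsvalP //= eqxx big_seq big1 ?addr0 //.
    by move=> w; rewrite in_fsetD1 => /andP[/negbTE ->].
  - have part0 : forall w, w \in Omega -> \sum_(t | fsval (tag t) == w) c t *: B t = 0.
      apply: ind; last by rewrite sumS.
      move=> w _; apply: subspace_sum => // t' /eqP <-.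
      exact: subspaceZ.
    case: t => w k; have := part0 _ (fsvalP w).
    under eq_bigl do rewrite val_eqE; rewrite sumT.
    by have [_ H _] := bU (fsval w); move=> /(H (fun k => c (Tagged _ k))); apply.
  rewrite SE => -[v Uv ->].
  have span (w : Omega) : exists d : 'I_(n (fsval w)) -> K,
      v (fsval w) = \sum_k d k *: b (fsval w) k.
    have [_ _ /(_ _ (Uv _ (fsvalP w)))[d /eqP]] := bU (fsval w).
    by rewrite subr_eq0 => /eqP e; exists d.
  pose d w := sval (cid (span w)).
  exists (fun t => d (tag t) (tagged t)).
  rewrite -(sumS (fun t => d (tag t) (tagged t) *: B t)) !big_seq_fsetE /=.
  apply: eq_bigr => w _; under eq_bigl do rewrite val_eqE.
  by rewrite sumT; exact: (svalP (cid (span w))).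
rewrite /edim (edim_quot_basis R subspace0 bS).
rewrite card_tagged sumnE big_map big_enum.
rewrite (eq_bigr (fun w => (n w)%:R%:E)); last first.
  by move=> w _; apply: edim_quot_basis (bU w); apply: subspace0.
rewrite sumEFin -natr_sum big_seq_fsetE /=; congr (_%:R%:E).
by apply: eq_bigr => w _; rewrite card_ord.
Qed.

End LinearAlgebra.

(** * Polynomials acting on sequences by translations *)

Section ShiftAction.
Variables (R : realType) (s : nat).
Local Notation seqs := ('rV[int]_s -> R[i]^o).
Local Notation poly := {mpoly R[i][s]}.
Implicit Types (c d f g : seqs) (p q : poly) (x y : 'rV[int]_s).

Lemma mnm_vecD m1 m2 : mnm_vec (m1 + m2)%MM = mnm_vec m1 + mnm_vec m2 :> 'rV_s.
Proof. by apply/rowP => i; rewrite !mxE mnmDE PoszD. Qed.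

Lemma mnm_vec0 : mnm_vec 0%MM = 0 :> 'rV_s.
Proof. by apply/rowP => i; rewrite !mxE mnm0E. Qed.

Lemma translate0 c : translate 0 c = c.
Proof. by apply/funext => x; rewrite /translate addr0. Qed.

Lemma translateA x y c : translate x (translate y c) = translate (x + y) c.
Proof. by apply/funext => z; rewrite /translate addrA. Qed.

Lemma translateDZ x a c d :
  translate x (a *: c + d) = a *: translate x c + translate x d.
Proof. by []. Qed.

Lemma translate_sum x (I : Type) (r : seq I) (P : pred I) (F : I -> seqs) :
  translate x (\sum_(i <- r | P i) F i) = \sum_(i <- r | P i) translate x (F i).
Proof. by apply/funext => y; rewrite /translate !fct_sumE. Qed.

(** The range of summation can be taken independent of [q], which makes linearity
    in [q] visible. *)
Lemma poly_shift_wide c q k : (msize q <= k)%N ->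
  poly_shift c q =
    \sum_(m : 'X_{1..s < k}) q@_m *: translate (mnm_vec m) c.
Proof.
move=> le; rewrite /poly_shift (ssrcomplements.big_mksub 'X_{1..s < k}) ?msupp_uniq //=;
  first last.
  by move=> x /msize_mdeg_lt/leq_trans/(_ le).
by rewrite big_rmcond //= => j /memN_msupp_eq0 ->; rewrite scale0r.
Qed.

Lemma poly_shiftE c q x :
  poly_shift c q x = \sum_(m <- msupp q) q@_m * c (x + mnm_vec m).
Proof. by rewrite /poly_shift fct_sumE. Qed.

Lemma poly_shift_is_linear c : linear (poly_shift c).
Proof.
move=> a p q; pose k := maxn (msize (a *: p + q)) (maxn (msize p) (msize q)).
rewrite !(@poly_shift_wide _ _ k) /k ?leq_max ?leqnn ?orbT //.
rewrite scaler_sumr -big_split; apply: eq_bigr => m _ /=.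
by rewrite mcoeffD mcoeffZ scalerDl scalerA.
Qed.

HB.instance Definition _ c :=
  GRing.isLinear.Build R[i] poly seqs *:%R (poly_shift c)
    (poly_shift_is_linear c).

Lemma poly_shiftDZl a c d q :
  poly_shift (a *: c + d) q = a *: poly_shift c q + poly_shift d q.
Proof.
rewrite /poly_shift scaler_sumr -big_split; apply: eq_bigr => m _ /=.
by rewrite translateDZ scalerDr !scalerA mulrC.
Qed.

Lemma poly_shift0l q : poly_shift 0 q = 0.
Proof.
by apply/funext => x; rewrite poly_shiftE big1 // => m _; rewrite mulr0.
Qed.

Lemma poly_shiftZl a c q : poly_shift (a *: c) q = a *: poly_shift c q.
Proof. by rewrite -[a *: c]addr0 poly_shiftDZl poly_shift0l addr0. Qed.

Lemma poly_shiftDl c d q : poly_shift (c + d) q = poly_shift c q + poly_shift d q.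
Proof. by rewrite -[c]scale1r poly_shiftDZl !scale1r. Qed.

Lemma poly_shift_suml (I : Type) (r : seq I) (P : pred I) (F : I -> seqs) q :
  poly_shift (\sum_(i <- r | P i) F i) q =
  \sum_(i <- r | P i) poly_shift (F i) q.
Proof.
elim/big_ind2: _ => [|c d c' d' <- <-|//]; first exact: poly_shift0l.
by rewrite poly_shiftDl.
Qed.

Lemma poly_shiftX c m : poly_shift c 'X_[m] = translate (mnm_vec m) c.
Proof. by rewrite /poly_shift msuppX big_seq1 mcoeffX eqxx scale1r. Qed.

Lemma poly_shift1 c : poly_shift c 1 = c.
Proof. by rewrite -mpolyX0 poly_shiftX mnm_vec0 translate0. Qed.

Lemma poly_shift_translate c q x :
  poly_shift (translate x c) q = translate x (poly_shift c q).
Proof.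
rewrite /poly_shift translate_sum; apply: eq_bigr => m _.
rewrite translateA addrC -translateA.
by rewrite -[_ *: _ in RHS]addr0 translateDZ addr0.
Qed.

Lemma poly_shiftM c p q : poly_shift c (p * q) = poly_shift (poly_shift c p) q.
Proof.
rewrite [in LHS](mpolyE p) mulr_suml linear_sum [poly_shift c p]/poly_shift.
rewrite poly_shift_suml; apply: eq_bigr => m _.
rewrite -scalerAl linearZ /= poly_shiftZl; congr (_ *: _).
rewrite poly_shift_translate [in LHS](mpolyE q) mulr_sumr linear_sum.
rewrite [in RHS]/poly_shift translate_sum; apply: eq_bigr => m' _.
rewrite -scalerAr linearZ /= -mpolyXD poly_shiftX mnm_vecD -translateA.
by rewrite -[_ *: _ in RHS]addr0 translateDZ addr0.
Qed.

Lemma poly_shift_annihilM c p q : poly_shift c p = 0 -> poly_shift c (q * p) = 0.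
Proof. by move=> cp; rewrite mulrC poly_shiftM cp poly_shift0l. Qed.

(** ** The space spanned by the translates *)

Lemma lspan_subspace (K : nzRingType) (V : lmodType K) (X : set V) :
  is_subspace (lspan X).
Proof.
split; first by exists 0%N, (fun=> 0), (fun=> 0); split=> [[]//|]; rewrite big_ord0.
move=> a _ _ [n [b [c [Xb ->]]]] [n' [b' [c' [Xb' ->]]]].
exists (n + n')%N, (fun i => match fintype.split i with inl j => b j | inr j => b' j end),
  (fun i => match fintype.split i with inl j => a * c j | inr j => c' j end).
split; first by move=> i; case: (fintype.split i).
rewrite big_split_ord /= scaler_sumr; congr (_ + _); apply: eq_bigr => i _.
  by rewrite (unsplitK (inl i)) scalerA.
by rewrite (unsplitK (inr i)).
Qed.

Lemma shift_space_subspace f : is_subspace (shift_space f).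
Proof. exact: lspan_subspace. Qed.

Lemma lspan_sub (K : nzRingType) (V : lmodType K) (X U : set V) :
  is_subspace U -> X `<=` U -> lspan X `<=` U.
Proof.
move=> [U0 UD] XU _ [n [b [c [Xb ->]]]]; elim/big_ind: _ => // [u v Uu Uv|i _].
  by rewrite -[u]scale1r; apply: UD.
by rewrite -[_ *: _]addr0; apply: UD => //; apply: XU.
Qed.

Lemma mem_lspan (K : nzRingType) (V : lmodType K) (X : set V) : X `<=` lspan X.
Proof.
move=> v Xv; exists 1%N, (fun=> v), (fun=> 1).
by rewrite big_ord1 scale1r.
Qed.

Lemma shift_space_translate f x g :
  shift_space f g -> shift_space f (translate x g).
Proof.
move=> [n [b [c [Xb ->]]]]; exists n, (fun i => translate x (b i)), c; split.
  by move=> i; have [y _ <-] := Xb i; exists (x + y) => //; rewrite translateA.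
by rewrite translate_sum.
Qed.

Lemma shift_space_self f : shift_space f f.
Proof. by apply: mem_lspan; exists 0 => //; rewrite translate0. Qed.

Lemma shift_space_poly f q g :
  shift_space f g -> shift_space f (poly_shift g q).
Proof.
move=> Sg; apply: subspace_sum => [|m _]; first exact: shift_space_subspace.
by apply: subspaceZ; [exact: shift_space_subspace|exact: shift_space_translate].
Qed.

Lemma shift_ker_subspace q : is_subspace (shift_ker q : set seqs).
Proof.
split; first exact: poly_shift0l.
by move=> a c d cq dq; rewrite /shift_ker /= poly_shiftDZl cq dq scaler0 addr0.
Qed.

Lemma shift_space_annihil f q : poly_shift f q = 0 -> shift_space f `<=` shift_ker q.
Proof.
move=> fq; apply: lspan_sub => [|_ [x _ <-]]; first exact: shift_ker_subspace.
by rewrite /shift_ker /= poly_shift_translate fq.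
Qed.

End ShiftAction.

(** * Factorization of a Hankel operator of finite rank *)

Section HankelFactorization.
Variables (R : realType) (s : nat).
Local Notation seqs := ('rV[int]_s -> R[i]^o).
Local Notation poly := {mpoly R[i][s]}.
Implicit Types (c d f g : seqs) (p q : poly) (x y : 'rV[int]_s).

(** Families of points may have repetitions, unlike the finite sets indexing
    [hankel_mx], so they can be bordered and translated freely. *)
Definition hankel_fam m n (a : 'I_m -> 'rV[int]_s) (b : 'I_n -> 'rV[int]_s) f :
  'M[R[i]]_(m, n) := \matrix_(i, j) f (a i + b j).

Lemma mxrank_mxsub (K : fieldType) m n m' n' (h : 'I_m' -> 'I_m)
    (k : 'I_n' -> 'I_n) (A : 'M[K]_(m, n)) :
  (\rank (mxsub h k A) <= \rank A)%N.
Proof.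
have rowsub_le m1 n1 m2 (l : 'I_m2 -> 'I_m1) (B : 'M[K]_(m1, n1)) :
    (\rank (rowsub l B) <= \rank B)%N.
  by apply/mxrankS/row_subP => i; rewrite row_rowsub row_sub.
rewrite mxsubrc; apply: leq_trans (rowsub_le _ _ _ _ _) _.
by rewrite -mxrank_tr trmx_mxsub -[X in (_ <= X)%N]mxrank_tr; apply: rowsub_le.
Qed.

Lemma mxrank_hankel_fam m n (a : 'I_m -> 'rV[int]_s) (b : 'I_n -> 'rV[int]_s) f :
  exists A B, (\rank (hankel_fam a b f) <= \rank (hankel_mx A B f))%N.
Proof.
pose A := [fset a i | i : 'I_m]%fset; pose B := [fset b i | i : 'I_n]%fset.
have aA i : (index (a i) A < size A)%N by rewrite index_mem in_imfset.
have bB i : (index (b i) B < size B)%N by rewrite index_mem in_imfset.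
exists A, B; suff -> : hankel_fam a b f = mxsub (fun i => Ordinal (aA i))
  (fun i => Ordinal (bB i)) (hankel_mx A B f) by apply: mxrank_mxsub.
by apply/matrixP => i j; rewrite !mxE /= !nth_index // in_imfset.
Qed.

Lemma hankel_rank_le A B f :
  ((\rank (hankel_mx A B f))%:R%:E <= hankel_rank f)%E.
Proof. by apply: ereal_sup_ubound; exists (A, B). Qed.

Lemma hankel_rank_ge0 f : (0 <= hankel_rank f)%E.
Proof. exact: le_trans (hankel_rank_le fset0 fset0 f). Qed.

Lemma hankel_rank_fin f : (hankel_rank f < +oo)%E ->
  exists A B, hankel_rank f = (\rank (hankel_mx A B f))%:R%:E /\
    forall A' B', (\rank (hankel_mx A' B' f) <= \rank (hankel_mx A B f))%N.
Proof.
move=> fin; have := hankel_rank_ge0 f.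
have [z zE] : exists z, hankel_rank f = z%:E.
  by case: (hankel_rank f) fin (hankel_rank_ge0 f) => [z||] //; exists z.
rewrite zE lee_fin => z0.
pose P n := `[< exists A B, \rank (hankel_mx A B f) = n >].
have exP : exists n, P n.
  by exists (\rank (hankel_mx fset0 fset0 f)); apply/asboolP; exists fset0, fset0.
have ubP n : P n -> (n <= Num.bound z)%N.
  move=> /asboolP[A [B <-]]; rewrite -(ler_nat R).
  have := hankel_rank_le A B f; rewrite zE lee_fin => /le_trans; apply.
  exact/ltW/archi_boundP.
case: (ex_maxnP exP ubP) => n /asboolP[A [B rE]] maxr; rewrite -zE; exists A, B.
have le A' B' : (\rank (hankel_mx A' B' f) <= \rank (hankel_mx A B f))%N.
  by rewrite rE; apply: maxr; apply/asboolP; exists A', B'.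
split=> //; apply/eqP; rewrite eq_le hankel_rank_le andbT.
by apply: ge_ereal_sup => _ [[A' B'] _ <-]; rewrite lee_fin ler_nat le.
Qed.

(** The Schur complement of the invertible block [hankel_fam a b f] in the
    matrix bordered by one more row and column is a scalar; it vanishes because
    the bordered matrix cannot have rank [r + 1]. *)
Lemma hankel_border r (a b : 'I_r -> 'rV[int]_s) f (N : 'M[R[i]]_r) :
  (forall m n (a' : 'I_m -> 'rV[int]_s) (b' : 'I_n -> 'rV[int]_s),
     (\rank (hankel_fam a' b' f) <= r)%N) ->
  hankel_fam a b f *m N = 1%:M ->
  forall x y,
    f (x + y) = \sum_i (\sum_j f (x + b j) * N j i) * f (a i + y).
Proof.
move=> maxr MN x y; set M := hankel_fam a b f in MN.
pose u := \row_j f (x + b j) : 'rV[R[i]]_r.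
pose v := \col_i f (a i + y) : 'cV[R[i]]_r.
pose w := (f (x + y))%:M : 'M[R[i]]_1.
have NM : N *m M = 1%:M by apply: mulmx1C.
have rk : (\rank (block_mx w u v M) <= r)%N.
  pose a' (i : 'I_(1 + r)) := match fintype.split i with inl _ => x | inr j => a j end.
  pose b' (i : 'I_(1 + r)) := match fintype.split i with inl _ => y | inr j => b j end.
  suff -> : block_mx w u v M = hankel_fam a' b' f by apply: maxr.
  apply/matrixP => i j; rewrite [RHS]mxE /a' /b' !mxE.
  case: (fintype.split i) => i'; rewrite !mxE; case: (fintype.split j) => j'; rewrite !mxE //.
  by rewrite !ord1 eqxx mulr1n.
pose d := w - u *m N *m v.
have prodE : block_mx 1%:M (- (u *m N)) 0 1%:M *m block_mx w u v M = block_mx d 0 v M.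
  rewrite mulmx_block !mul1mx !mul0mx !add0r /d !mulNmx; congr block_mx.
  by rewrite -mulmxA NM mulmx1 subrr.
have d0 : d = 0.
  apply/eqP/contraT => dn0; have : block_mx d 0 v M \in unitmx.
    rewrite unitmxE det_lblock unitrM -!unitmxE (mulmx1_unit MN).1 andbT.
    rewrite unitmxE [d]mx11_scalar det_scalar expr1 unitfE.
    by apply: contra dn0 => /eqP e; rewrite [d]mx11_scalar e -scalemx1 scale0r.
  rewrite -row_full_unit -prodE => /eqP full.
  have := mxrankM_maxr (block_mx 1%:M (- (u *m N)) 0 1%:M) (block_mx w u v M).
  by move=> /leq_trans/(_ rk); rewrite full add1n ltnn.
have : d 0 0 = 0 by rewrite d0 mxE.
rewrite mxE mxE eqxx mulr1n => /eqP; rewrite mxE subr_eq0 => /eqP ->.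
rewrite !mxE; apply: eq_bigr => i _; rewrite !mxE; congr (_ * _).
by apply: eq_bigr => j _; rewrite !mxE.
Qed.

(** Translating the row points by [g] and the column points by [- g] leaves the
    matrix unchanged, so all row points can be moved into the positive orthant. *)
Lemma hankel_factor f : (hankel_rank f < +oo)%E ->
  exists r (a : 'I_r -> 'X_{1..s}) (b : 'I_r -> 'rV[int]_s) (N : 'M[R[i]]_r),
  [/\ hankel_rank f = r%:R%:E,
      hankel_fam (fun i => mnm_vec (a i)) b f *m N = 1%:M &
      forall x y,
        f (x + y) = \sum_i (\sum_j f (x + b j) * N j i) * f (mnm_vec (a i) + y)].
Proof.
move=> /hankel_rank_fin[A [B [rE maxr]]].
set M0 := hankel_mx A B f in rE maxr; pose h := maxrankfun M0.
have full : row_full (rowsub h M0)^T by rewrite /row_full mxrank_tr; apply: maxrowsub_free.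
pose k := fullrankfun full.
pose a0 (i : 'I_(\rank M0)) : 'rV[int]_s := nth 0 A (h i).
pose b0 (j : 'I_(\rank M0)) : 'rV[int]_s := nth 0 B (k j).
pose g : 'X_{1..s} := [multinom (\sum_i absz (a0 i ord0 l))%N | l < s].
pose a i : 'X_{1..s} := [multinom absz ((a0 i + mnm_vec g)%R ord0 l) | l < s].
have aE i : mnm_vec (a i) = a0 i + mnm_vec g.
  apply/rowP => l; rewrite !mxE mnmE gez0_abs ?mxE // mnmE.
  rewrite (bigD1 i) //= PoszD addrA ler_wpDr // -lerBlDl sub0r abszE.
  by rewrite -normrN ler_norm.
pose b j := b0 j - mnm_vec g.
have MU : hankel_fam (fun i => mnm_vec (a i)) b f \in unitmx.
  suff -> : hankel_fam (fun i => mnm_vec (a i)) b f = (rowsub k (rowsub h M0)^T)^T.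
    by rewrite unitmx_tr; apply: fullrowsub_unit.
  by apply/matrixP => i j; rewrite !mxE aE /b addrCA addrK addrC.
exists (\rank M0), a, b, (invmx (hankel_fam (fun i => mnm_vec (a i)) b f)); split=> //.
  exact: mulmxV.
apply: hankel_border (mulmxV MU) => m n a' b'.
by have [A' [B' /leq_trans]] := mxrank_hankel_fam a' b' f; apply.
Qed.

(** Both sides are linear in [g], and for a translate of [f] this is the
    factorization. So the translates by the [a i] span the space, and the values at
    the [b j] determine its elements. *)
Lemma shift_space_factor f r (a b : 'I_r -> 'rV[int]_s) (N : 'M[R[i]]_r) g :
  (forall x y, f (x + y) = \sum_i (\sum_j f (x + b j) * N j i) * f (a i + y)) ->
  shift_space f g ->
  g = \sum_i (\sum_j g (b j) * N j i) *: translate (a i) f.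
Proof.
move=> fE [n [h [k [Xh ->]]]]; apply/funext => y.
rewrite fct_sumE.
under eq_bigr => l _.
  have [x _ hE] := Xh l.
  have -> : (k l *: h l) y =
    \sum_i (\sum_j k l * h l (b j) * N j i) * f (a i + y).
    rewrite -hE; transitivity (k l * f (x + y)); first by rewrite [x + y]addrC.
    rewrite fE mulr_sumr; apply: eq_bigr => i _; rewrite mulrA mulr_sumr.
    congr (_ * _); apply: eq_bigr => j _.
    by rewrite mulrA /translate [b j + x]addrC.
  over.
rewrite exchange_big fct_sumE; apply: eq_bigr => i _ /=.
rewrite -mulr_suml exchange_big /translate addrC.
congr (_ * _); apply: eq_bigr => j _.
by rewrite mulr_suml.
Qed.

End HankelFactorization.

(** * Univariate polynomials in one translation *)

Section Univariate.
Variables (K : fieldType) (s : nat) (i : 'I_s).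
Implicit Types u : {poly K}.

Lemma horner_alg_mnm u :
  horner_alg ('X_i : {mpoly K[s]}) u =
  \sum_(k < size u) u`_k *: 'X_[(U_(i) *+ k)%MM].
Proof.
rewrite -[u in LHS]coefK poly_def linear_sum; apply: eq_bigr => k _.
by rewrite linearZ /= rmorphXn /= horner_algX mpolyXn mulr_algl.
Qed.

Lemma mcoeff_horner_alg u (k : nat) :
  (horner_alg ('X_i : {mpoly K[s]}) u)@_(U_(i) *+ k)%MM = u`_k.
Proof.
rewrite horner_alg_mnm linear_sum /=.
have eqX (l : nat) : ((U_(i) *+ l)%MM == (U_(i) *+ k)%MM :> 'X_{1..s}) = (l == k).
  apply/eqP/eqP => [/mnmP/(_ i)|-> //].
  by rewrite !mulmnE mnm1E eqxx !mul1n.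
under eq_bigr do rewrite mcoeffZ mcoeffX eqX.
have [le|lt] := leqP (size u) k.
  rewrite nth_default // big1 // => l _.
  by rewrite ltn_eqF ?mulr0 // (leq_trans (ltn_ord l)).
rewrite (bigD1 (Ordinal lt)) //= eqxx mulr1 big1 ?addr0 // => l nlk.
by move: nlk; rewrite -val_eqE => /negbTE /= ->; rewrite mulr0.
Qed.

(** The size of [u] bounds the degree of a leading monomial that is a power of the
    variable; such bounds make the search for a Groebner basis finite. *)
Lemma mlead_horner_alg u : u != 0 ->
  exists2 k, mlead (horner_alg ('X_i : {mpoly K[s]}) u) = (U_(i) *+ k)%MM
    & (k < size u)%N.
Proof.
move=> u0; set p := horner_alg _ u.
have p0 : p != 0.
  apply: contraNneq u0 => pE; rewrite -lead_coef_eq0 lead_coefE.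
  by rewrite -mcoeff_horner_alg -/p pE mcoeff0.
have := mlead_supp p0; rewrite mcoeff_msupp.
move: (mlead p) => m /eqP nz; apply: contrapT => H; case: nz.
rewrite /p horner_alg_mnm linear_sum /=; apply: big1 => k _.
rewrite mcoeffZ mcoeffX; case: eqP => [e|_]; last by rewrite mulr0.
by case: H; exists k.
Qed.

End Univariate.

(** * Groebner bases of ideals of finite codimension *)

Section GroebnerBasis.
Variables (K : fieldType) (s : nat).
Local Notation poly := {mpoly K[s]}.
Local Notation lemnm := (fun m1 m2 : 'X_{1..s} => (m1 <= m2)%O).
Implicit Types (I J : set poly) (p q g : poly).

Lemma monomial_order_lemc : monomial_order lemnm.
Proof.
split=> [|m|m1 m2 m]; [|exact: le0x|by rewrite lemc_add2l].
by split; [exact: lexx|exact: le_anti|move=> ? ? ?; exact: le_trans|exact: le_total].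
Qed.

Lemma mlead_is_leading p : p != 0 -> is_leading_monomial lemnm p (mlead p).
Proof. by move=> p0; split; [apply: mlead_supp|move=> m /msupp_le_mlead]. Qed.

Lemma is_leading_mlead p m : is_leading_monomial lemnm p m ->
  p != 0 /\ m = mlead p.
Proof.
move=> [mp maxm]; have p0 : p != 0.
  by apply: contraTneq mp => ->; rewrite msupp0.
split=> //; apply/le_anti; rewrite msupp_le_mlead //=.
exact/maxm/mlead_supp.
Qed.

Lemma idealB I p q : is_ideal I -> I p -> I q -> I (p - q).
Proof.
by move=> [_ ID IM] Ip Iq; rewrite -mulN1r; apply: ID => //; apply: IM.
Qed.

Lemma idealZ I a p : is_ideal I -> I p -> I (a *: p).
Proof. by move=> [_ _ IM] Ip; rewrite -mul_mpolyC; apply: IM. Qed.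

(** Over a field and for [G] contained in [I], this is equivalent to the equality of
    the ideals generated by the leading terms; it is the form that division with
    remainder uses. *)
Definition divides_leads I (G : set poly) := forall p, I p -> p != 0 ->
  exists g, [/\ G g, g != 0 & (mlead g <= mlead p)%MM].

(** Subtracting a multiple of an element of [G] lowers the leading monomial, and
    the monomial order is well founded. *)
Lemma groebner_generates I (G : set poly) J :
  is_ideal I -> G `<=` I -> divides_leads I G ->
  is_ideal J -> G `<=` J -> I `<=` J.
Proof.
move=> iI GI dG iJ GJ p; move: {2}(mlead p) (erefl (mlead p)) => m.
elim/(@ltmwf s): m p => m IH p mE Ip.
have [->|p0] := eqVneq p 0; first by case: iJ.
have [g [Gg g0 dvd]] := dG _ Ip p0; rewrite mE in dvd.
have lg0 : g@_(mlead g) != 0 by rewrite mleadc_eq0.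
pose h := (p@_m / g@_(mlead g)) *: (g * 'X_[(m - mlead g)%MM]).
have hm : h@_m = p@_m.
  by rewrite /h mcoeffZ -{2}(submK dvd) mcoeffMX divfK.
have lh : (mlead h <= m)%O.
  apply: le_trans (mleadZ_le _ _) _; rewrite mleadM -?msupp_eq0 ?msuppX ?msupp_eq0 //.
  by rewrite mleadXm addmC submK.
have [Ih Jh] : I h /\ J h.
  by split; apply: idealZ => //; rewrite mulrC;
     [case: iI => _ _; apply; apply: GI|case: iJ => _ _; apply; apply: GJ].
rewrite -[p](subrK h).
have [_ JD _] := iJ; apply: JD => //.
have [-> |q0] := eqVneq (p - h) 0; first by case: iJ.
apply: (IH (mlead (p - h))) => //; last exact: idealB.
rewrite lt_neqAle; apply/andP; split.
  apply: contraNneq q0 => e.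
  by rewrite -mleadc_eq0 e mcoeffB hm subrr.
by apply: le_trans (mleadB_le _ _) _; rewrite leUx mE lexx.
Qed.

Lemma divides_leads_groebner I (G : {fset poly}) :
  [set` G] `<=` I -> divides_leads I [set` G] -> is_groebner_basis I G.
Proof.
move=> GI dG; exists lemnm; split=> //; first exact: monomial_order_lemc.
apply/seteqP; split=> t Ht J iJ JL; apply: Ht => // {t} _ [p [m [Pp lm ->]]].
  by apply: JL; exists p, m; split=> //; apply: GI.
have [p0 ->] := is_leading_mlead lm.
have [g [Gg g0 dvd]] := dG _ Pp p0.
have lg0 : g@_(mlead g) != 0 by rewrite mleadc_eq0.
have -> : p@_(mlead p) *: 'X_[mlead p] =
    ((p@_(mlead p) / g@_(mlead g)) *: 'X_[(mlead p - mlead g)%MM]) *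
      (g@_(mlead g) *: 'X_[mlead g]) :> poly.
  by rewrite -scalerAl -scalerAr scalerA -mpolyXD submK // divfK.
have [_ _ JM] := iJ; apply: JM; apply: JL; exists g, (mlead g); split=> //.
exact: mlead_is_leading.
Qed.

(** If every variable has a power of exponent at most [k] among the leading
    monomials of [I], then a monomial of degree more than [s * k] is a multiple
    of one of these powers; so finitely many leading monomials suffice. *)
Lemma exists_finite_divides_leads I k : is_ideal I ->
  (forall i, exists p e,
     [/\ I p, p != 0, mlead p = (U_(i) *+ e)%MM & (e <= k)%N]) ->
  exists G : {fset poly}, [set` G] `<=` I /\ divides_leads I [set` G].
Proof.
move=> iI pureP.
have /choice[h Hh] : forall m, exists p, I p /\
    ((exists q, [/\ I q, q != 0 & mlead q = m]) -> p != 0 /\ mlead p = m).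
  move=> m; have [[q [Iq q0 qm]]|nq] := pselect (exists q, [/\ I q, q != 0 & mlead q = m]).
    by exists q.
  by exists 0; split=> //; case: iI.
pose B := (s * k + k).+1.
pose G := [fset h (bmnm m) | m : 'X_{1..s < B}]%fset.
have GI : [set` G] `<=` I by move=> _ /= /imfsetP[m _ ->]; case: (Hh (bmnm m)).
have memG p : I p -> p != 0 -> (mdeg (mlead p) < B)%N ->
    exists g, [/\ [set` G] g, g != 0 & mlead g = mlead p].
  move=> Ip p0 lt; exists (h (mlead p)).
  have [|h0 hE] := (Hh (mlead p)).2; first by exists p.
  by split=> //=; apply/imfsetP; exists (BMultinom lt).
exists G; split=> // p Ip p0; have [lt|ge] := ltnP (mdeg (mlead p)) B.
  have [g [Gg g0 gE]] := memG _ Ip p0 lt; exists g; split=> //.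
  by rewrite gE lepm_refl.
have [i ki] : exists i, (k < mlead p i)%N.
  apply: contrapT => H; move: ge; apply/negP; rewrite -ltnNge ltnS mdegE.
  apply: leq_trans (leq_addr _ _); rewrite -[X in (_ <= X * _)%N]card_ord -sum_nat_const.
  by apply: leq_sum => i _; rewrite leqNgt; apply/negP => ki; apply: H; exists i.
have [q [e [Iq q0 qE ek]]] := pureP i.
have [|g [Gg g0 gE]] := memG q Iq q0.
  rewrite qE mdegMn mdeg1 mul1n ltnS; apply: leq_trans ek _.
  exact: leq_addl.
exists g; split=> //; rewrite gE qE; apply/mnm_lepP => j.
rewrite mulmnE mnm1E; case: eqP => [<-|_] //.
by rewrite mul1n; apply: leq_trans ek (ltnW ki).
Qed.

End GroebnerBasis.

(** * The annihilating ideal of a sequence of finite Hankel rank *)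

Section AnnihilatingIdeal.
Variables (R : realType) (s : nat).
Local Notation seqs := ('rV[int]_s -> R[i]^o).
Local Notation poly := {mpoly R[i][s]}.
Implicit Types (c d f g : seqs) (p q : poly) (x y : 'rV[int]_s).

Definition annihilator f : set poly := [set q | poly_shift f q = 0].

Lemma annihilator_ideal f : is_ideal (annihilator f).
Proof.
split; rewrite /annihilator /= ?linear0 //.
  by move=> p q fp fq; rewrite linearD /= fp fq addr0.
by move=> q p; apply: poly_shift_annihilM.
Qed.

Lemma annihilator_subspace f : is_subspace (annihilator f).
Proof.
have [I0 ID _] := annihilator_ideal f; split=> // a p q fp fq; apply: ID => //.
by rewrite /annihilator /= linearZ /= fp scaler0.
Qed.

(** The [r + 1] sequences obtained from [g] by iterating one translation have
    linearly dependent vectors of values at the [r] points [b j]. *)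
Lemma exists_univariate_annihilator f r (b : 'I_r -> 'rV[int]_s) g (i : 'I_s) :
  (forall h, shift_space f h -> (forall j, h (b j) = 0) -> h = 0) ->
  shift_space f g ->
  exists u : {poly R[i]}, [/\ u != 0, (size u <= r.+1)%N &
    poly_shift g (horner_alg ('X_i : poly) u) = 0].
Proof.
move=> inj Sg.
pose A := \matrix_(k < r.+1, j < r) poly_shift g ('X_i ^+ k) (b j) : 'M[R[i]]_(_, _).
have [v v0 vA] := exists_left_kernel A (ltnSn r).
exists (rVpoly v); split; [|exact: size_poly|].
  apply: contraNneq v0 => e; apply/eqP/rowP => k.
  by rewrite -coef_rVpoly_ord e coef0 mxE.
apply: inj => [|j]; first exact: shift_space_poly.
have -> : rVpoly v = \sum_(k < r.+1) v 0 k *: 'X^k.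
  by rewrite /rVpoly poly_def; apply: eq_bigr => k _; rewrite valK.
rewrite 2!linear_sum fct_sumE /= -[RHS](_ : (v *m A) 0 j = 0); last by rewrite vA mxE.
rewrite mxE; apply: eq_bigr => k _.
by rewrite !linearZ /= rmorphXn /= horner_algX mxE mulr_algl linearZ.
Qed.

Section Factored.
Variables (f : seqs) (r : nat) (a : 'I_r -> 'X_{1..s}) (b : 'I_r -> 'rV[int]_s).
Variable N : 'M[R[i]]_r.
Hypothesis MN : hankel_fam (fun i => mnm_vec (a i)) b f *m N = 1%:M.
Hypothesis fE : forall x y,
  f (x + y) = \sum_i (\sum_j f (x + b j) * N j i) * f (mnm_vec (a i) + y).

Lemma shift_space_eq0 g : shift_space f g -> (forall j, g (b j) = 0) -> g = 0.
Proof.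
move=> Sg gb; rewrite (shift_space_factor fE Sg) big1 // => i _.
by rewrite big1 ?scale0r // => j _; rewrite gb mul0r.
Qed.

Lemma translate_indep (c : 'I_r -> R[i]) :
  \sum_i c i *: translate (mnm_vec (a i)) f = 0 -> forall i, c i = 0.
Proof.
move=> c0; have cM : \row_i c i *m hankel_fam (fun i => mnm_vec (a i)) b f = 0.
  apply/rowP => j; rewrite !mxE -[RHS](_ : (0 : seqs) (b j) = 0) // -c0 fct_sumE.
  by apply: eq_bigr => i _; rewrite !mxE [mnm_vec _ + _]addrC.
move=> i; have : \row_i c i = 0 by rewrite -[LHS]mulmx1 -MN mulmxA cM mul0mx.
by move=> /rowP/(_ i); rewrite !mxE.
Qed.

Lemma shift_space_basis :
  basis_mod (shift_space f) [set 0] (fun i => translate (mnm_vec (a i)) f).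
Proof.
split; [by move=> i; apply/shift_space_translate/shift_space_self|
        exact: translate_indep|].
move=> g Sg; exists (fun i => \sum_j g (b j) * N j i).
by rewrite /= -(shift_space_factor fE Sg) subrr.
Qed.

Lemma annihilator_basis :
  basis_mod [set: poly] (annihilator f) (fun i => 'X_[a i]).
Proof.
have shiftE (c : 'I_r -> R[i]) : poly_shift f (\sum_i c i *: 'X_[a i]) =
    \sum_i c i *: translate (mnm_vec (a i)) f.
  by rewrite linear_sum; apply: eq_bigr => i _; rewrite linearZ /= poly_shiftX.
split=> // [c|p _]; first by rewrite /annihilator /= shiftE; apply: translate_indep.
exists (fun i => \sum_j poly_shift f p (b j) * N j i).
rewrite /annihilator /= linearB /= shiftE -(shift_space_factor fE) ?subrr //.
exact/shift_space_poly/shift_space_self.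
Qed.

(** For [x] in the lattice, [z^x] is congruent modulo the annihilator of [f] to
    the combination of the [z^(a i)] given by the factorization. Hence any
    sequence killed by the annihilator satisfies the same recurrence as [f]. *)
Lemma annihilator_kernel c :
  (forall q, annihilator f q -> poly_shift c q = 0) -> shift_space f c.
Proof.
move=> cI.
have cE x : c x = \sum_i (\sum_j f (x + b j) * N j i) * c (mnm_vec (a i)).
  (* [x] need not be in the positive orthant, but [x + k] and [k] are; the
     relation for [z ^ (x + k)] is evaluated at [- k]. *)
  pose k := [multinom absz (x ord0 l) | l < s].
  pose m := [multinom absz ((x + mnm_vec k)%R ord0 l) | l < s].
  have mE : mnm_vec m = x + mnm_vec k.
    apply/rowP => l; rewrite !mxE mnmE gez0_abs ?mxE // mnmE.
    by rewrite -lerBlDl sub0r abszE -normrN ler_norm.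
  pose C i := \sum_j f (x + b j) * N j i.
  pose q : poly := 'X_[m] - \sum_i C i *: 'X_[(a i + k)%MM].
  have qE d y : poly_shift d q y =
      d (y + mnm_vec m) - \sum_i C i * d (y + mnm_vec (a i) + mnm_vec k).
    rewrite /q linearB /= (linear_sum (poly_shift d)) poly_shiftX.
    rewrite [LHS]/(_ - _) fct_sumE; congr (_ - _); apply: eq_bigr => i _.
    by rewrite linearZ /= poly_shiftX mnm_vecD -addrA.
  have /cI/(congr1 (fun d : seqs => d (- mnm_vec k))) : annihilator f q.
    apply/funext => y; rewrite qE mE addrA addrAC [_ + x]addrC fE.
    apply/eqP; rewrite subr_eq0; apply/eqP; apply: eq_bigr => i _.
    by rewrite [y + mnm_vec k]addrC addrA [y + _]addrC addrAC.
  rewrite qE mE [- _ + _]addrC addrK => /eqP; rewrite subr_eq0 => /eqP ->.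
  by apply: eq_bigr => i _; rewrite addrAC [- _ + _]addrC addrN add0r.
have -> : c = \sum_j (\sum_i N j i * c (mnm_vec (a i))) *: translate (b j) f.
  apply/funext => x; rewrite cE fct_sumE.
  transitivity (\sum_i \sum_j f (x + b j) * N j i * c (mnm_vec (a i))).
    by apply: eq_bigr => i _; rewrite mulr_suml.
  rewrite exchange_big; apply: eq_bigr => j _ /=.
  transitivity ((\sum_i N j i * c (mnm_vec (a i))) * f (x + b j)) => //.
  rewrite mulr_suml; apply: eq_bigr => i _.
  by rewrite -mulrA mulrC.
apply: subspace_sum => [|j _]; first exact: shift_space_subspace.
apply: subspaceZ; first exact: shift_space_subspace.
exact/shift_space_translate/shift_space_self.
Qed.

Lemma shift_space_kernel :
  shift_space f = \bigcap_(q in annihilator f) shift_ker q.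
Proof.
apply/seteqP; split=> [g Sg q /shift_space_annihil|c cI]; first exact.
exact: annihilator_kernel.
Qed.

Lemma annihilator_groebner : exists G : {fset poly},
  is_groebner_basis (annihilator f) G /\
  \bigcap_(q in annihilator f) (shift_ker q : set seqs) =
  \bigcap_(g in [set` G]) shift_ker g.
Proof.
have [|G [GI dG]] := @exists_finite_divides_leads _ _ (annihilator f) r
    (annihilator_ideal f).
  move=> i; have [u [u0 su fu]] :=
    exists_univariate_annihilator i shift_space_eq0 (shift_space_self f).
  have [k lE ku] := mlead_horner_alg i u0.
  exists (horner_alg 'X_i u), k; split=> //; last by rewrite -ltnS (leq_trans ku).
  apply: contraNneq u0 => e; apply/eqP/polyP => l.
  by rewrite -(mcoeff_horner_alg i) e mcoeff0 coef0.
exists G; split; first exact: divides_leads_groebner.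
apply/seteqP; split=> c cI q; first by move=> /GI; apply: cI.
exact: (groebner_generates (annihilator_ideal f) GI dG (annihilator_ideal c)).
Qed.

End Factored.
End AnnihilatingIdeal.

(** * A kernel space spanned by the translates of one sequence is finite dimensional *)

Section Diagonal.
Variables (R : realType) (s : nat).
Local Notation seqs := ('rV[int]_s -> R[i]^o).
Local Notation poly := {mpoly R[i][s]}.
Implicit Types (f g phi : seqs) (q : poly) (x y : 'rV[int]_s).

Definition lattice_pt (k : nat) : 'rV[int]_s := odflt 0 (choice.unpickle k).

Lemma lattice_ptK x : lattice_pt (choice.pickle x) = x.
Proof. by rewrite /lattice_pt choice.pickleK. Qed.

Lemma complex_archi (z : R[i]) : exists n : nat, `|z| <= n%:R.
Proof.
rewrite normc_def; set r := Num.sqrt _; exists (Num.bound r).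
rewrite -[X in _ <= X](rmorph_nat (real_complex R)) lecR.
exact/ltW/archi_boundP/sqrtr_ge0.
Qed.

(** A relation between the rows of [f] that holds in the columns of the first [n]
    lattice points gives an element of [shift_space f] vanishing at these points, so
    it holds in every column. *)
Lemma hankel_rank_finite_test f n :
  (forall g, shift_space f g ->
     (forall k, (k < n)%N -> g (lattice_pt k) = 0) -> g = 0) ->
  (hankel_rank f < +oo)%E.
Proof.
move=> inj; apply: (@le_lt_trans _ _ n%:R%:E); last exact: ltry.
apply: ge_ereal_sup => _ [[A B] _ <-] /=; rewrite lee_fin ler_nat.
pose E := \matrix_(i < size A, k < n) f (nth 0 A i + lattice_pt k).
apply: leq_trans (rank_leq_col E).
suff : (kermx E <= kermx (hankel_mx A B f))%MS.
  by move=> /mxrankS; rewrite !mxrank_ker leq_sub2lE ?rank_leq_row.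
apply/row_subP => i; set u := row i _.
have uE : u *m E = 0 by apply/sub_kermxP/row_sub.
pose g : seqs := \sum_j u 0 j *: translate (nth 0 A j) f.
have gE x : g x = \sum_j u 0 j * f (nth 0 A j + x).
  by rewrite /g fct_sumE; apply: eq_bigr => j _; rewrite addrC.
have g0 : g = 0.
  apply: inj => [|k kn].
    apply: subspace_sum => [|j _]; first exact: shift_space_subspace.
    apply: subspaceZ; first exact: shift_space_subspace.
    exact/shift_space_translate/shift_space_self.
  rewrite gE; have /rowP/(_ (Ordinal kn)) := uE; rewrite !mxE => e.
  by rewrite -[RHS]e; apply: eq_bigr => j _; rewrite [E _ _]mxE.
apply/sub_kermxP/rowP => k; rewrite !mxE -[RHS](_ : g (nth 0 B k) = 0).
  by rewrite gE; apply: eq_bigr => j _; rewrite [hankel_mx _ _ _ _ _]mxE.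
by rewrite g0.
Qed.

(** The factor [j] absorbs the coefficients of a finite combination of translates,
    and the sum absorbs the translates, as soon as [j] is large enough. *)
Definition growth f (j : nat) : R[i] :=
  j%:R * \sum_(k < j.+1) `|f (lattice_pt j + lattice_pt k)|.

Lemma growth_ge0 f j : 0 <= growth f j.
Proof. by rewrite mulr_ge0 // sumr_ge0. Qed.

Lemma growth_dominates f g : shift_space f g ->
  exists J, forall j, (J <= j)%N -> `|g (lattice_pt j)| <= growth f j.
Proof.
move=> [n [h [c [Xh ->]]]].
have /choice[x xE] : forall l, exists x, translate x f = h l.
  by move=> l; have [x _ <-] := Xh l; exists x.
have [C HC] := complex_archi (\sum_l `|c l|).
exists (maxn C (\max_l choice.pickle (x l))) => j; rewrite geq_max => /andP[Cj xj].
rewrite fct_sumE; apply: le_trans (ler_norm_sum _ _ _) _.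
apply: (@le_trans _ _ (\sum_l `|c l| *
    \sum_(k < j.+1) `|f (lattice_pt j + lattice_pt k)|)).
  apply: ler_sum => l _; rewrite -xE normrM ler_wpM2l //.
  have lj : (choice.pickle (x l) < j.+1)%N.
    rewrite ltnS (leq_trans _ xj) //.
    exact: (@leq_bigmax _ (fun l => choice.pickle (x l)) l).
  rewrite (bigD1 (Ordinal lj)) //= lattice_ptK ler_wpDr //.
  exact: sumr_ge0.
rewrite -mulr_suml ler_wpM2r ?sumr_ge0 //.
move: HC; rewrite ger0_norm ?sumr_ge0 // => /le_trans; apply.
by rewrite ler_nat.
Qed.

(** If the rank is infinite, a sequence can be built in the kernel space whose
    value exceeds [growth f] infinitely often: each correction step uses a
    nonzero element vanishing on a prescribed initial segment of the lattice,
    so that the corrections form a locally finite sum. No finite combination of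
    translates of [f] grows like that. *)
Lemma kernel_space_finite_rank f (I : set poly) :
  shift_space f = \bigcap_(q in I) shift_ker q -> (hankel_rank f < +oo)%E.
Proof.
move=> SE; apply: contrapT => inf; set S := shift_space f in SE.
have sS : is_subspace S := shift_space_subspace f.
pose agree n (g h : seqs) := forall k, (k < n)%N -> g (lattice_pt k) = h (lattice_pt k).
have small n : exists g, [/\ S g, g <> 0 & agree n g 0].
  apply: contrapT => H; apply: inf; apply: (@hankel_rank_finite_test f n) => g Sg gn.
  by apply: contrapT => g0; apply: H; exists g.
have /choice[F HF] : forall t : seqs * nat, exists t' : seqs * nat, S t.1 ->
    [/\ S t'.1, (t.2 < t'.2)%N, agree t.2 t'.1 t.1 &
      exists j, [/\ (t.2 <= j)%N, (j < t'.2)%N &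
        ~~ (`|t'.1 (lattice_pt j)| <= growth f j)]].
  move=> [phi n]; have [g [Sg g0 gn]] := small n.
  have [x gx] : exists x, g x != 0.
    apply: contrapT => H; apply: g0; apply/funext => x.
    by have [//|gx] := eqVneq (g x) 0; case: H; exists x.
  have nx : (n <= choice.pickle x)%N.
    rewrite leqNgt; apply/negP => /gn; rewrite lattice_ptK => e.
    by rewrite e eqxx in gx.
  (* The coefficient that makes the new value at [x] equal to [growth + 1]. *)
  pose a : R[i] := (growth f (choice.pickle x) + 1 - phi x) / g x.
  exists (a *: g + phi, (choice.pickle x).+1) => /= Sphi; split=> //.
  - by case: sS => _; apply.
  - by move=> k kn; rewrite -[LHS]/(a * g (lattice_pt k) + _) gn // mulr0 add0r.
  exists (choice.pickle x); split=> //; rewrite lattice_ptK -[_ x]/(a * g x + phi x).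
  rewrite /a divfK // subrK ger0_norm ?addr_ge0 ?growth_ge0 //.
  rewrite -real_ltNge ?ger0_real ?addr_ge0 ?growth_ge0 //.
  by rewrite ltrDl.
pose t n := iter n F ((0 : seqs), 0%N).
have St n : S (t n).1.
  by elim: n => [|n IH] /=; [case: sS|case: (HF _ IH)].
have tn n : (n <= (t n).2)%N.
  elim: n => // n IH; have [_ lt _ _] := HF _ (St n).
  exact: leq_ltn_trans IH lt.
have tagree n m : (n <= m)%N -> agree (t n).2 (t m).1 (t n).1 /\ ((t n).2 <= (t m).2)%N.
  move=> /subnKC <-; elim: (m - n)%N => [|d [IH le]]; first by rewrite addn0.
  rewrite addnS; have [_ lt ag _] := HF _ (St (n + d)%N).
  split; last exact: leq_trans le (ltnW lt).
  by move=> k kn; rewrite -IH //; apply: ag; apply: leq_trans kn le.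
pose phi : seqs := fun x => (t (choice.pickle x).+1).1 x.
have phiE n : agree (t n).2 phi (t n).1.
  move=> k kn; set x := lattice_pt k; pose m := maxn n (choice.pickle x).+1.
  have [agn _] := @tagree n m (leq_maxl _ _); rewrite -(agn k kn).
  have [agx _] := @tagree (choice.pickle x).+1 m (leq_maxr _ _).
  by have := agx (choice.pickle x) (tn _); rewrite lattice_ptK => ->.
have Sphi : S phi.
  rewrite SE => q Iq; apply/funext => y; rewrite poly_shiftE.
  pose n := (\sum_(m <- msupp q) (choice.pickle (y + mnm_vec m)%R).+1)%N.
  have : S (t n).1 by [].
  rewrite SE => /(_ q Iq)/(congr1 (fun c : seqs => c y)); rewrite poly_shiftE => <-.
  rewrite big_seq [RHS]big_seq; apply: eq_bigr => m mq; congr (_ * _).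
  rewrite -[y + _]lattice_ptK; apply: phiE; apply: leq_trans (tn n).
  by rewrite /n (big_rem m) //= leq_addr.
have [J HJ] := growth_dominates Sphi.
have [_ _ _ [j [Jj jlt /negP]]] := HF _ (St J); apply.
rewrite -[F (t J)]/(t J.+1) -phiE //; apply: HJ.
exact: leq_trans (tn J) Jj.
Qed.

End Diagonal.

(** * Exponentials and their frequencies *)

Section Exponentials.
Variables (R : realType) (s : nat).
Local Notation seqs := ('rV[int]_s -> R[i]^o).
Local Notation poly := {mpoly R[i][s]}.
Implicit Types (w : freq R s) (x y : 'rV[int]_s).

Lemma exp_dotD (a t : 'I_s -> R) x y :
  exp_dot a t (x + y) = exp_dot a t x * exp_dot a t y.
Proof.
have dotD (u : 'I_s -> R) : \sum_i u i * ((x + y) 0 i)%:~R =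
    \sum_i u i * (x 0 i)%:~R + \sum_i u i * (y 0 i)%:~R.
  by rewrite -big_split; apply: eq_bigr => i _; rewrite mxE intrD mulrDr.
rewrite /exp_dot !dotD expRD rmorphM cosD sinD mulrACA; congr (_ * _).
by simpc; rewrite [X in (_ +i* X)%C]addrC.
Qed.

Lemma exp_dot0 (a t : 'I_s -> R) : exp_dot a t 0 = 1.
Proof.
have dot0 (u : 'I_s -> R) : \sum_i u i * ((0 : 'rV[int]_s) 0 i)%:~R = 0 :> R.
  by rewrite big1 // => i _; rewrite mxE mulr0.
by rewrite /exp_dot !dot0 expR0 cos0 sin0 mul1r.
Qed.

Lemma exp_dot_delta (a t : 'I_s -> R) i :
  exp_dot a t (mnm_vec U_(i)) = (expR (a i))%:C%C * (cos (t i) +i* sin (t i))%C.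
Proof.
have dotd (u : 'I_s -> R) : \sum_j u j * (mnm_vec U_(i) 0 j)%:~R = u i.
  rewrite (bigD1 i) //= big1 ?addr0 => [|j ji]; first by rewrite mxE mnm1E eqxx mulr1.
  by rewrite mxE mnm1E eq_sym (negbTE ji) mulr0.
by rewrite /exp_dot !dotd.
Qed.

Lemma exp_freqD w x y : exp_freq w (x + y) = exp_freq w x * exp_freq w y.
Proof. exact: exp_dotD. Qed.

Lemma exp_freq_neq0 w x : exp_freq w x != 0.
Proof.
apply: contra_neq (oner_neq0 R[i]) => e.
by rewrite -[1](exp_dot0 (fun i => (w 0 i).1) (fun i => repr (w 0 i).2)) -(subrr x)
  [exp_dot _ _ _]exp_freqD e mul0r.
Qed.

(** The factor by which the translation in direction [i] multiplies [exp_freq w]. *)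
Definition multiplier w i := exp_freq w (mnm_vec U_(i)).

Lemma multiplierE w (t : 'I_s -> R) i :
  (forall i, \pi_(torus R)%qT (t i) = (w 0 i).2) ->
  multiplier w i = (expR (w 0 i).1)%:C%C * (cos (t i) +i* sin (t i))%C.
Proof. by move=> ht; rewrite /multiplier (exp_freqE _ ht) exp_dot_delta. Qed.

Lemma polar (z : R[i]) : z != 0 ->
  exists a t : R, z = (expR a)%:C%C * (cos t +i* sin t)%C.
Proof.
case: z => x y z0; pose r := Num.sqrt (x ^+ 2 + y ^+ 2).
have n0 : 0 < x ^+ 2 + y ^+ 2.
  rewrite lt0r addr_ge0 ?sqr_ge0 // andbT paddr_eq0 ?sqr_ge0 // !sqrf_eq0.
  by apply: contra z0 => /andP[/eqP-> /eqP->].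
have r0 : 0 < r by rewrite sqrtr_gt0.
have rr : r ^+ 2 = x ^+ 2 + y ^+ 2 by rewrite sqr_sqrtr // ltW.
have circ : (y / r) ^+ 2 = 1 - (x / r) ^+ 2.
  apply/eqP; rewrite eq_sym subr_eq !expr_div_n -mulrDl addrC -rr divff //.
  by rewrite gt_eqF ?exprn_gt0.
have xr : -1 <= x / r <= 1.
  rewrite -ler_norml -(@ler_pXn2r _ 2) ?nnegrE // expr1n real_normK ?num_real //.
  by rewrite -subr_ge0 -circ sqr_ge0.
have polar_sin t : cos t = x / r -> sin t = y / r ->
    (x +i* y)%C = (expR (ln r))%:C%C * (cos t +i* sin t)%C.
  move=> -> ->; rewrite lnK ?posrE //; simpc.
  by rewrite ![r * _]mulrC !divfK ?gt_eqF.
have sinE : sin (acos (x / r)) = `|y / r| by rewrite sin_acos // -circ sqrtr_sqr.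
exists (ln r); have [y0|y0] := leP 0 (y / r).
  exists (acos (x / r)); apply: polar_sin; first by rewrite acosK.
  by rewrite sinE ger0_norm.
exists (- acos (x / r)); apply: polar_sin; first by rewrite cosN acosK.
by rewrite sinN sinE ltr0_norm // opprK.
Qed.

Lemma exists_multiplier (l : 'I_s -> R[i]) :
  (forall i, l i != 0) -> exists w, forall i, multiplier w i = l i.
Proof.
move=> l0; have /choice[a Ha] : forall i, exists at_ : R * R,
    l i = (expR at_.1)%:C%C * (cos at_.2 +i* sin at_.2)%C.
  by move=> i; have [a [t e]] := polar (l0 i); exists (a, t).
exists (\row_i ((a i).1, \pi_(torus R)%qT (a i).2)) => i.
rewrite (@multiplierE _ (fun i => (a i).2)) ?mxE //.
by move=> j; rewrite mxE.
Qed.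

(** After removing full periods, the cosine is injective on each half of the
    remaining interval. *)
Lemma cos_eq1 (d : R) : cos d = 1 -> exists k : int, d = 2 * pi * k%:~R.
Proof.
move=> cd; have pi2 : 0 < 2 * pi :> R by rewrite mulr_gt0 ?pi_gt0.
pose k := Num.floor (d / (2 * pi)); exists k; pose e := d - 2 * pi * k%:~R.
have ce : cos e = 1 by rewrite -(cos_sin_2pi e k).1 subrK.
have /andP[] := floor_itv (d / (2 * pi)); rewrite -/k.
rewrite ler_pdivlMr // ltr_pdivrMr // intrD [(k%:~R + _) * _]mulrDl.
rewrite mul1r ![_%:~R * _]mulrC.
rewrite -subr_ge0 -/e -ltrBlDl -/e => e0 e2.
apply/eqP; rewrite -subr_eq0 -/e; apply/eqP; have [epi|epi] := leP e pi.
  by apply: cos_inj; rewrite ?in_itv /= ?e0 ?epi ?lexx ?pi_ge0 // ce cos0.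
have : 2 * pi - e = 0.
  apply: cos_inj; rewrite ?in_itv /= ?lexx ?pi_ge0 //.
    by rewrite subr_ge0 ltW //= lerBlDr mulr_natl mulr2n lerD2l ltW.
  have := (cos_sin_2pi (- e) 1).1.
  by rewrite mulr1z mulr1 cosN ce cos0 addrC.
by move=> /eqP; rewrite subr_eq0 gt_eqF.
Qed.

Lemma multiplier_inj w w' : (forall i, multiplier w i = multiplier w' i) -> w = w'.
Proof.
move=> eqw; apply/rowP => i; have := eqw i.
have mE v : multiplier v i =
    (expR (v 0 i).1)%:C%C * (cos (repr (v 0 i).2) +i* sin (repr (v 0 i).2))%C.
  by apply: (@multiplierE _ (fun i => repr (v 0 i).2)) => j; rewrite reprK.
rewrite !mE; case: (w 0 i) (w' 0 i) => [a p] [a' p'] /=; simpc.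
move=> [ec es]; have ea : expR a = expR a'.
  apply/eqP; rewrite -(@eqrXn2 _ 2) ?expR_ge0 //; apply/eqP.
  rewrite -[LHS]mulr1 -[RHS]mulr1 -{1}(cos2Dsin2 (repr p)) -(cos2Dsin2 (repr p')).
  by rewrite !mulrDr -!exprMn ec es.
rewrite ea in ec es; rewrite (expR_inj ea); congr (_, _).
have e0 : expR a' != 0 by rewrite gt_eqF ?expR_gt0.
have [k kE] : exists k : int, repr p - repr p' = 2 * pi * k%:~R.
  by apply: cos_eq1; rewrite cosB (mulfI e0 ec) (mulfI e0 es) -!expr2 cos2Dsin2.
rewrite -[p]reprK -[p']reprK; apply/eqmodP; apply/asboolP.
by exists k.
Qed.

End Exponentials.

(** * Exponential polynomials have finite Hankel rank *)

Lemma mpoly_ring_ind (s : nat) (K : comNzRingType) (P : {mpoly K[s]} -> Prop) :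
  (forall c, P c%:MP) -> (forall p q, P p -> P q -> P (p + q)) ->
  (forall i p, P p -> P ('X_i * p)) -> forall p, P p.
Proof.
move=> PC PD PX; elim/mpolyind => [|c m p _ _ Pp]; first exact: PC.
apply: PD => //; rewrite -mul_mpolyC mulrC mpolyXE_id.
suff : forall q, P q -> P ((\prod_(i < s) 'X_i ^+ m i) * q) by apply; apply: PC.
elim/big_ind: _ => [q|p1 p2 P1 P2 q Pq|i _ q Pq]; first by rewrite mul1r.
  by rewrite -mulrA; apply/P1/P2.
by elim: (m i) => [|k IH]; rewrite ?mul1r // exprS -mulrA; apply: PX.
Qed.

Section Separable.
Variables (R : realType) (s : nat).
Local Notation seqs := ('rV[int]_s -> R[i]^o).
Local Notation poly := {mpoly R[i][s]}.
Implicit Types (f g : seqs) (p q : poly) (x y : 'rV[int]_s).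

(** Separability bounds the rank of every finite section of the Hankel operator
    by the number of terms, and is stable under sums and products. *)
Definition separable f := exists (T : finType) (a b : T -> seqs),
  forall x y, f (x + y) = \sum_t a t x * b t y.

Lemma separable_hankel_rank f : separable f -> (hankel_rank f < +oo)%E.
Proof.
move=> [T [a [b fE]]]; apply: (@le_lt_trans _ _ #|T|%:R%:E); last exact: ltry.
apply: ge_ereal_sup => _ [[A B] _ <-] /=; rewrite lee_fin ler_nat.
pose P := \matrix_(i < size A, k < #|T|) a (enum_val k) (nth 0 A i) : 'M[R[i]]_(_, _).
pose Q := \matrix_(k < #|T|, j < size B) b (enum_val k) (nth 0 B j) : 'M[R[i]]_(_, _).
suff -> : hankel_mx A B f = P *m Q by apply: mulmx_max_rank.
apply/matrixP => i j; rewrite !mxE fE big_enum_val /=.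
by apply: eq_bigr => k _; rewrite !mxE.
Qed.

Lemma separable_mult g : (forall x y, g (x + y) = g x * g y) -> separable g.
Proof.
move=> gD; exists unit, (fun=> g), (fun=> g) => x y.
by rewrite gD (big_pred1 tt) // => -[].
Qed.

Lemma separableD f g : separable f -> separable g -> separable (f + g).
Proof.
move=> [T [a [b fE]]] [T' [a' [b' gE]]].
exists (T + T')%type, (fun t => match t with inl u => a u | inr u => a' u end),
  (fun t => match t with inl u => b u | inr u => b' u end) => x y.
by rewrite big_sumType /= -fE -gE.
Qed.

Lemma separableM f g : separable f -> separable g ->
  separable (fun x => f x * g x).
Proof.
move=> [T [a [b fE]]] [T' [a' [b' gE]]].
exists (T * T')%type, (fun t x => a t.1 x * a' t.2 x),
  (fun t x => b t.1 x * b' t.2 x) => x y.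
rewrite fE gE mulr_suml -(pair_bigA _ (fun t t' => a t x * a' t' x * (b t y * b' t' y))) /=.
apply: eq_bigr => t _; rewrite mulr_sumr; apply: eq_bigr => t' _.
by rewrite mulrACA.
Qed.

Lemma separable_eval_int p : separable (eval_int p).
Proof.
elim/mpoly_ring_ind: p => [c|p q sp sq|i p sp].
- exists unit, (fun _ _ => c), (fun _ _ => 1) => x y.
  by rewrite /eval_int mevalC (big_pred1 tt) ?mulr1 // => -[].
- rewrite (_ : eval_int _ = eval_int p + eval_int q :> seqs); first exact: separableD.
  by apply/funext => x; rewrite /eval_int mevalD.
rewrite (_ : eval_int _ = fun x => (x 0 i)%:~R * eval_int p x); last first.
  by apply/funext => x; rewrite /eval_int mevalM mevalXU.
apply: separableM sp; exists bool, (fun t x => if t then (x 0 i)%:~R else 1),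
  (fun t y => if t then 1 else (y 0 i)%:~R) => x y.
by rewrite big_bool mulr1 mul1r mxE intrD.
Qed.

Lemma separable_sum (T : Type) (r : seq T) (F : T -> seqs) :
  (forall t, separable (F t)) -> separable (\sum_(t <- r) F t).
Proof.
move=> sF; elim/big_ind: _ => //; last exact: separableD.
by exists void, (fun=> 0), (fun=> 0) => x y; rewrite big1 // => -[].
Qed.

Lemma separable_exp_poly p (w : freq R s) :
  separable (fun x => eval_int p x * exp_freq w x).
Proof.
apply: separableM; first exact: separable_eval_int.
exact: separable_mult (exp_freqD w).
Qed.

End Separable.

(** * Decomposition into joint generalized eigensequences of the translations *)

Section PrimaryDecomposition.
Variables (R : realType) (s : nat).
Local Notation seqs := ('rV[int]_s -> R[i]^o).
Local Notation poly := {mpoly R[i][s]}.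
Implicit Types (f g h u : seqs) (p q : poly) (x y : 'rV[int]_s).

Definition killed g i (l : R[i]) k := poly_shift g (('X_i - l%:MP) ^+ k) = 0.

Definition generalized_eigen (l : 'I_s -> R[i]) g := forall i, exists k, killed g i (l i) k.

Lemma poly_shift_swap g p q : poly_shift (poly_shift g p) q = poly_shift (poly_shift g q) p.
Proof. by rewrite -!poly_shiftM mulrC. Qed.

Lemma killed_poly_shift g i l k q : killed g i l k -> killed (poly_shift g q) i l k.
Proof. by rewrite /killed poly_shift_swap => ->; rewrite poly_shift0l. Qed.

Lemma killedW g i l k m : killed g i l k -> killed g i l (k + m).
Proof.
by rewrite /killed exprD poly_shiftM => ->; rewrite poly_shift0l.
Qed.

Lemma horner_alg_XsubC_exp i (l : R[i]) k :
  horner_alg ('X_i : poly) (('X - l%:P) ^+ k) = ('X_i - l%:MP) ^+ k.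
Proof. by rewrite rmorphXn rmorphB /= horner_algX horner_algC alg_mpolyC. Qed.

Lemma killed_eq0 g i l k m n : l != m -> killed g i l k -> killed g i m n -> g = 0.
Proof.
move=> lm gl gm; have : coprimep (('X - l%:P) ^+ k) (('X - m%:P) ^+ n).
  by apply/coprimep_expl/coprimep_expr; rewrite coprimep_XsubC root_XsubC eq_sym.
move=> /Bezout_eq1_coprimepP[[a b] /= /(congr1 (horner_alg ('X_i : poly)))].
rewrite rmorphD !rmorphM rmorph1 /= !horner_alg_XsubC_exp => e.
rewrite -[g]poly_shift1 -e linearD /= !poly_shift_annihilM // addr0.
by [].
Qed.

(** Splitting off one root of an annihilating polynomial at a time, by Bezout. That
    [g] is a sum of killed sequences is expressed by membership in every set [T]
    that contains them and is closed under addition. *)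
Lemma univariate_primary i (u : {poly R[i]}) (T : set seqs) g :
  T 0 -> (forall h h', T h -> T h' -> T (h + h')) ->
  u != 0 -> poly_shift g (horner_alg 'X_i u) = 0 ->
  (forall v l k, let h := poly_shift g (horner_alg 'X_i v) in killed h i l k -> T h) ->
  T g.
Proof.
move=> T0 TD; have [n] := ubnP (size u); elim: n u g => [|n IH] u g; first by rewrite ltn0.
rewrite ltnS => le u0 gu HT.
have [su1|su1] := eqVneq (size u) 1%N.
  have /eqP/size_poly1P[c c0 uE] := su1.
  suff g0 : g = 0 by rewrite g0.
  move: gu; rewrite uE horner_algC linearZ /= poly_shift1 => /eqP.
  by rewrite scaler_eq0 (negbTE c0) => /eqP.
have /closed_rootP[l rl] := su1.
have [m [w nrw uE]] := multiplicity_XsubC u l; rewrite u0 /= in nrw.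
have m0 : (0 < m)%N.
  rewrite lt0n; apply: contraTneq rl => m0.
  by rewrite uE m0 expr0 mulr1.
have w0 : w != 0 by apply: contraNneq nrw => ->; rewrite root0.
have : coprimep w (('X - l%:P) ^+ m) by apply/coprimep_expr; rewrite coprimep_XsubC.
move=> /Bezout_eq1_coprimepP[[a b] /= abE].
pose A := horner_alg ('X_i : poly).
have gE : g = poly_shift g (A (a * w)) + poly_shift g (A (b * ('X - l%:P) ^+ m)).
  by rewrite -linearD -rmorphD abE rmorph1 /= poly_shift1.
rewrite gE; apply: TD.
  apply: (HT _ l m); rewrite /killed -horner_alg_XsubC_exp -poly_shiftM -rmorphM.
  rewrite -mulrA -uE rmorphM; exact: poly_shift_annihilM.
apply: (IH w _ _ w0).
- apply: leq_trans le; rewrite uE size_Mmonic ?monic_exp ?monicXsubC //.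
  by rewrite size_exp_XsubC addnS /= -addn1 leq_add2l.
- rewrite -poly_shiftM -rmorphM -mulrA [_ ^+ m * w]mulrC -uE rmorphM.
  exact: poly_shift_annihilM.
by move=> v l' k /=; rewrite -poly_shiftM -rmorphM; apply: HT.
Qed.

(** The directions are treated one after the other. A summand obtained for one
    direction is the image of [g] under a polynomial in the translations, so it
    remains killed in the directions treated before. *)
Lemma primary_decomposition (S T : set seqs) :
  (forall g q, S g -> S (poly_shift g q)) ->
  (forall g i, S g ->
     exists2 u : {poly R[i]}, u != 0 & poly_shift g (horner_alg 'X_i u) = 0) ->
  T 0 -> (forall h h', T h -> T h' -> T (h + h')) ->
  (forall l h, S h -> generalized_eigen l h -> T h) ->
  S `<=` T.
Proof.
move=> SP Su T0 TD ST.
suff H n : (n <= s)%N -> forall g, S g ->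
    (forall i : 'I_s, (n <= i)%N -> exists l k, killed g i l k) -> T g.
  by move=> g Sg; apply: (H s) => // i; rewrite leqNgt ltn_ord.
elim: n => [_ g Sg gk|n IH ns g Sg gk].
  have /choice[l Hl] : forall i, exists l, exists k, killed g i l k.
    by move=> i; apply: gk.
  exact: (ST l).
pose i0 := Ordinal ns; have [u u0 gu] := Su g i0 Sg.
apply: (univariate_primary T0 TD u0 gu) => v l k /= hk.
apply: IH; [exact: ltnW|exact: SP|] => i; rewrite leq_eqVlt => /predU1P[e|lt].
  have -> : i = i0 by apply: val_inj; rewrite /= e.
  by exists l, k.
by have [l' [k' gk']] := gk i lt; exists l', k'; apply: killed_poly_shift.
Qed.

(** Sequences belonging to distinct systems of eigenvalues are independent: a
    product of powers of the [X_i - l] kills all terms but one, on which it acts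
    injectively. *)
Lemma generalized_eigen_indep (J : choiceType) (Omega : {fset J})
    (l : J -> 'I_s -> R[i]) (v : J -> seqs) :
  (forall w w', (forall i, l w i = l w' i) -> w = w') ->
  (forall w, w \in Omega -> generalized_eigen (l w) (v w)) ->
  \sum_(w <- Omega) v w = 0 -> forall w, w \in Omega -> v w = 0.
Proof.
move=> linj ev v0 w0 w0O.
have /choice[P HP] : forall w, exists p, w \in Omega -> w != w0 ->
    poly_shift (v w) p = 0 /\
    forall h, generalized_eigen (l w0) h -> poly_shift h p = 0 -> h = 0.
  move=> w; have [wO|nwO] := boolP (w \in Omega); last by exists 0.
  have [->|ww0] := eqVneq w w0; first by exists 0; rewrite ?eqxx.
  have [i li] : exists i, l w i != l w0 i.
    apply: contrapT => H; move/eqP: ww0; apply; apply: linj => i.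
    by apply/eqP; rewrite -[_ == _]negbK; apply/negP => li; apply: H; exists i.
  have [k vk] := ev w wO i.
  exists (('X_i - (l w i)%:MP) ^+ k) => _ _; split=> // h hl hk.
  by have [m hm] := hl i; apply: (killed_eq0 li hk hm).
pose Q := \prod_(w <- Omega | w != w0) P w.
have Qinj h : generalized_eigen (l w0) h -> poly_shift h Q = 0 -> h = 0.
  rewrite /Q big_seq_cond; elim/big_rec: _ h => [h _|w q /andP[wO ww0] IH h hl].
    by rewrite poly_shift1.
  rewrite poly_shiftM poly_shift_swap => hq; apply: (IH h hl).
  apply: (HP w wO ww0).2 hq => i; have [k hk] := hl i; exists k.
  exact: killed_poly_shift.
apply: Qinj; first exact: ev.
have : poly_shift (\sum_(w <- Omega) v w) Q = 0 by rewrite v0 poly_shift0l.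
rewrite (big_fsetD1 w0) //= poly_shiftDl poly_shift_suml big_seq big1 ?addr0 //.
move=> w; rewrite in_fsetD1 => /andP[ww0 wO].
rewrite /Q big_mkcond (big_fsetD1 w) //= ww0 poly_shiftM.
by rewrite (HP w wO ww0).1 poly_shift0l.
Qed.

End PrimaryDecomposition.

(** * Generalized eigensequences are exponential polynomials *)

(** Digits in base [D]: the exponents of distinct monomials remain distinct after
    the substitution of the powers [t ^ (D ^ i)] of a single variable. *)
Lemma digits_inj D n (a b : 'I_n -> nat) :
  (forall i, (a i < D)%N) -> (forall i, (b i < D)%N) ->
  (\sum_(i < n) D ^ i * a i = \sum_(i < n) D ^ i * b i)%N -> a =1 b.
Proof.
elim: n a b => [a b _ _ _ []//|n IH a b aD bD]; rewrite !big_ord_recl !expn0 !mul1n.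
have shift (c : 'I_n.+1 -> nat) : (\sum_(i < n) D ^ lift ord0 i * c (lift ord0 i) =
    (\sum_(i < n) D ^ i * c (lift ord0 i)) * D)%N.
  by rewrite big_distrl; apply: eq_bigr => i _; rewrite expnS -mulnA mulnC.
rewrite !shift => e; have ab0 : a ord0 = b ord0.
  have := congr1 (modn^~ D) e.
  by rewrite /= ![(_ + _ * D)%N]addnC !modnMDl !modn_small.
have D0 : (0 < D)%N by apply: leq_ltn_trans (aD ord0).
move: e; rewrite ab0 => /addnI/eqP; rewrite eqn_pmul2r // => /eqP e i.
case: (unliftP ord0 i) => [k|] -> //.
by apply: (IH (fun k => a (lift ord0 k)) (fun k => b (lift ord0 k))).
Qed.

Section Newton.
Variables (R : realType) (s : nat).
Local Notation seqs := ('rV[int]_s -> R[i]^o).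
Local Notation poly := {mpoly R[i][s]}.
Implicit Types (f g h u : seqs) (p q : poly) (x y : 'rV[int]_s) (i j : 'I_s).
Local Notation e_ i := (mnm_vec U_(i) : 'rV[int]_s).
Definition diff i : poly := 'X_i - 1%:MP.

Lemma mnm_vec1E i j : (e_ i 0 j)%:~R = (i == j)%:R :> R[i].
Proof. by rewrite mxE mnm1E -pmulrn. Qed.

Lemma poly_shift_XsubC u i (l : R[i]) x :
  poly_shift u ('X_i - l%:MP) x = u (x + e_ i) - l * u x.
Proof.
by rewrite linearB /= -[l%:MP]mulr1 mul_mpolyC linearZ /= poly_shift1 poly_shiftX.
Qed.

Lemma poly_shift_diff u i x : poly_shift u (diff i) x = u (x + e_ i) - u x.
Proof. by rewrite poly_shift_XsubC mul1r. Qed.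

(** Twisting by an exponential conjugates [X_i - multiplier w i] to a difference. *)
Lemma killed_exp u w i k x :
  poly_shift (fun x => u x * exp_freq w x) (('X_i - (multiplier w i)%:MP) ^+ k) x =
  multiplier w i ^+ k * poly_shift u (diff i ^+ k) x * exp_freq w x.
Proof.
elim: k u x => [|k IH] u x; first by rewrite !expr0 !poly_shift1 mul1r.
rewrite exprS poly_shiftM [diff i ^+ _]exprS poly_shiftM.
rewrite (_ : poly_shift _ ('X_i - _) =
    fun x => (multiplier w i *: poly_shift u (diff i)) x * exp_freq w x).
  rewrite (IH (multiplier w i *: poly_shift u (diff i))) poly_shiftZl exprSr; congr (_ * _).
  by rewrite [(_ *: _) x]/(multiplier w i * _) mulrA.
apply/funext => y; rewrite poly_shift_XsubC exp_freqD -/(multiplier w i).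
rewrite [(_ *: _) y]/(multiplier w i * _) poly_shift_diff.
have aux (a b c d : R[i]) : a * (c * d) - d * (b * c) = d * (a - b) * c.
  by rewrite mulrBr mulrBl mulrA [_ * d]mulrC !mulrA.
exact: aux.
Qed.

Lemma killed_exp_iff u w i k :
  killed (fun x => u x * exp_freq w x) i (multiplier w i) k <->
  killed u i 1 k.
Proof.
rewrite /killed -/(diff i); split=> e; apply/funext => x; last first.
  by rewrite killed_exp e mulr0 mul0r.
have /eqP := congr1 (fun c : seqs => c x) e.
rewrite killed_exp mulf_eq0 (negbTE (exp_freq_neq0 _ _)) orbF mulf_eq0.
by rewrite expf_eq0 (negbTE (exp_freq_neq0 _ _)) andbF => /eqP.
Qed.

(** By the Leibniz rule, the difference of the product is the product with the
    difference of [u], plus a translate of [u] when [i = j]. *)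
Lemma killed_coordM u i j k : killed u i 1 k ->
  killed (fun x => (x 0 j)%:~R * u x) i 1 k.+1.
Proof.
rewrite /killed -/(diff i); elim: k u => [|k IH] u.
  rewrite expr0 poly_shift1 => ->; apply/funext => x.
  by rewrite expr1 poly_shift_diff !mulr0 subrr.
rewrite exprS poly_shiftM => Hu; rewrite exprS poly_shiftM.
rewrite (_ : poly_shift _ (diff i) = (i == j)%:R *: translate (e_ i) u +
    (fun x => (x 0 j)%:~R * poly_shift u (diff i) x)).
  rewrite poly_shiftDZl IH // poly_shift_translate exprS poly_shiftM Hu.
  by apply/funext => x; rewrite addr0 [LHS]mulr0.
apply/funext => x; rewrite poly_shift_diff.
rewrite [RHS]/((i == j)%:R * u (x + e_ i) + (x 0 j)%:~R * poly_shift u (diff i) x).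
rewrite poly_shift_diff mxE intrD mnm_vec1E.
have aux (a b c d : R[i]) : (a + d) * b - a * c = d * b + a * (b - c).
  by rewrite mulrBr mulrDl addrAC addrC addrA.
exact: aux.
Qed.

Lemma killed_eval_int q i : exists k, killed (eval_int q) i 1 k.
Proof.
elim/mpoly_ring_ind: q => [c|p q [k pk] [m qm]|j p [k pk]].
- exists 1; apply/funext => x.
  by rewrite expr1 poly_shift_diff /eval_int !mevalC subrr.
- exists (k + m)%N; rewrite (_ : eval_int _ = eval_int p + eval_int q :> seqs).
    rewrite /killed poly_shiftDl (killedW m pk) addnC (killedW k qm).
    exact: addr0.
  by apply/funext => x; rewrite /eval_int mevalD.
exists k.+1; rewrite (_ : eval_int _ = fun x => (x 0 j)%:~R * eval_int p x :> R[i]^o).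
  exact: killed_coordM.
by apply/funext => x; rewrite /eval_int mevalM mevalXU.
Qed.

(** The generalized binomial coefficient [z] over [k], defined for all [z]. *)
Fixpoint gbinom (k : nat) (z : R[i]) : R[i] :=
  if k is m.+1 then (z - m%:R) / m.+1%:R * gbinom m z else 1.

(** Pascal's rule makes these the iterated antidifferences of 1. *)
Lemma gbinomS k z : gbinom k.+1 (z + 1) = gbinom k.+1 z + gbinom k z.
Proof.
elim: k => [|k IH].
  by rewrite /= !subr0 !divr1 !mulr1.
have nz m : m.+1%:R != 0 :> R[i] by rewrite pnatr_eq0.
rewrite [LHS]/= -/(gbinom k.+1 (z + 1)) IH.
have zk : (z - k%:R) * gbinom k z = k.+1%:R * gbinom k.+1 z.
  by rewrite /= mulrA [_ * (_ / _)]mulrC divfK.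
rewrite [gbinom k.+2 z]/= -/(gbinom k.+1 z).
have -> : z + 1 - k.+1%:R = z - k%:R by rewrite -addn1 natrD opprD addrACA subrr addr0.
move: (gbinom k.+1 z) (gbinom k z) zk => g1 g0 zk.
apply: (mulIf (nz k.+1)); rewrite [RHS]mulrDl.
rewrite [_ / _ * (g1 + g0)]mulrAC divfK // [_ / _ * g1]mulrAC divfK // mulrDr zk.
rewrite [g1 * _]mulrC -!mulrDl; congr (_ * _).
by rewrite -[k.+2]addn1 natrD addrA subrK -[k.+1]addn1 natrD addrA subrK.
Qed.

Lemma gbinom0 k : gbinom k.+1 0 = 0.
Proof. by elim: k => [|k IH] /=; rewrite ?subrr ?mul0r // -/(gbinom k.+1 0) IH mulr0. Qed.

Definition poly_fun u := exists q, u = eval_int q.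

Lemma poly_funD u v : poly_fun u -> poly_fun v -> poly_fun (u + v).
Proof.
move=> [p ->] [q ->]; exists (p + q); apply/funext => x.
by rewrite /eval_int mevalD.
Qed.

Lemma poly_funM u (v : seqs) : poly_fun u -> poly_fun v -> poly_fun (fun x => u x * v x).
Proof.
move=> [p ->] [q ->]; exists (p * q); apply/funext => x.
by rewrite /eval_int mevalM.
Qed.

Lemma poly_fun_sum n (F : 'I_n -> seqs) : (forall k, poly_fun (F k)) ->
  poly_fun (fun x => \sum_k F k x).
Proof.
move=> PF; rewrite (_ : (fun x => _) = \sum_k F k); last first.
  by apply/funext => x; rewrite fct_sumE.
elim/big_ind: _ => //; last exact: poly_funD.
by exists 0; apply/funext => x; rewrite /eval_int meval0.
Qed.

Lemma poly_fun_cst (c : R[i]) : poly_fun (fun=> c).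
Proof. by exists c%:MP; apply/funext => x; rewrite /eval_int mevalC. Qed.

Lemma poly_fun_gbinom k j : poly_fun (fun x => gbinom k (x 0 j)%:~R).
Proof.
elim: k => [|k IH] /=; first exact: poly_fun_cst.
apply: (poly_funM _ IH); exists (k.+1%:R^-1 *: ('X_j - k%:R%:MP)); apply/funext => x.
by rewrite /eval_int mevalZ mevalB mevalXU mevalC mulrC.
Qed.

Definition zero_at j x : 'rV[int]_s := \row_i (if i == j then 0 else x 0 i).

Lemma zero_atD j x i : i != j -> zero_at j (x + e_ i) = zero_at j x + e_ i.
Proof.
move=> ij; apply/rowP => l; rewrite !mxE mnm1E.
by case: (eqVneq l j) ij => [->|] // /negbTE ->.
Qed.

Lemma zero_atD1 j x : zero_at j (x + e_ j) = zero_at j x.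
Proof.
apply/rowP => l; rewrite !mxE mnm1E eq_sym.
by case: (eqVneq l j) => // _; rewrite addr0.
Qed.

Lemma zero_at_id j x : zero_at j (zero_at j x) = zero_at j x.
Proof. by apply/rowP => l; rewrite !mxE; case: eqP. Qed.

Lemma periodic_zero_at g j :
  (forall x, g (x + e_ j) = g x) -> forall x, g x = g (zero_at j x).
Proof.
move=> per x.
have perM n y : g (y + e_ j *+ n) = g y.
  by elim: n => [|n IH]; rewrite ?mulr0n ?addr0 // mulrSr addrA per.
have eE n l : (e_ j *+ n) 0 l = if l == j then n%:Z else 0.
  by rewrite mulmxnE mxE mnm1E eq_sym; case: eqP; rewrite ?mul0rn // natz.
case xE: (x 0 j) => [n|n].
  suff {1}-> : x = zero_at j x + e_ j *+ n by apply: perM.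
  by apply/rowP => l; rewrite mxE eE mxE; case: eqP => [->|]; rewrite ?add0r ?addr0.
suff -> : zero_at j x = x + e_ j *+ n.+1 by rewrite perM.
apply/rowP => l; rewrite mxE [RHS]mxE eE; case: eqP => [->|]; rewrite ?addr0 //.
by rewrite xE NegzE addNr.
Qed.

(** Newton's forward difference formula in the coordinate [j]: the difference of
    the two sides is invariant under the translation and vanishes at [x 0 j = 0]. *)
Lemma newton_formula K u j : killed u j 1 K -> forall x,
  u x = \sum_(k < K) gbinom k (x 0 j)%:~R * poly_shift u (diff j ^+ k) (zero_at j x).
Proof.
rewrite /killed -/(diff j); elim: K u => [|K IH] u.
  by rewrite expr0 poly_shift1 => -> x; rewrite big_ord0.
rewrite exprS poly_shiftM => /IH {}IH.
pose v : seqs := fun x =>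
  \sum_(k < K.+1) gbinom k (x 0 j)%:~R * poly_shift u (diff j ^+ k) (zero_at j x).
have vD x : v (x + e_ j) - v x = u (x + e_ j) - u x.
  rewrite -[RHS]poly_shift_diff IH /v !big_ord_recl !expr0 zero_atD1 mxE intrD mnm_vec1E eqxx.
  rewrite addrC opprD addrACA addNr add0r addrC -sumrB; apply: eq_bigr => k _.
  by rewrite gbinomS mulrDl addrAC subrr add0r exprS poly_shiftM.
have aux (p q r t : R[i]) : q - t = p - r -> p - q = r - t.
  by move=> h; rewrite -[p](subrK r) -h; ring.
have uv x : u x - v x = u (zero_at j x) - v (zero_at j x).
  by apply: (@periodic_zero_at (fun x => u x - v x)) => {}x; apply: aux (vD x).
move=> x; apply/eqP; rewrite -subr_eq0 -/(v x) uv subr_eq0; apply/eqP.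
rewrite /v big_ord_recl expr0 poly_shift1 zero_at_id mul1r big1 ?addr0 // => k _.
by rewrite !mxE eqxx gbinom0 mul0r.
Qed.

(** Newton's formula is applied to one coordinate after the other: its coefficients
    no longer depend on that coordinate and are still killed in all directions. *)
Lemma newton u : (forall i, exists k, killed u i 1 k) -> poly_fun u.
Proof.
suff H n : (n <= s)%N -> forall u : seqs, (forall i, exists k, killed u i 1 k) ->
    (forall x y, (forall i, (i < n)%N -> x 0 i = y 0 i) -> u x = u y) -> poly_fun u.
  move=> uk; apply: (H s) => // x y xy; congr (u _).
  by apply/rowP => i; apply: xy; apply: ltn_ord.
elim: n => [_ {}u _ dep|n IH ns {}u uk dep].
  suff -> : u = fun=> u 0 by apply: poly_fun_cst.
  by apply/funext => x; apply: dep.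
pose j := Ordinal ns; have [K uj] := uk j.
rewrite (_ : u = fun x => \sum_(k < K) gbinom k (x 0 j)%:~R *
    poly_shift u (diff j ^+ k) (zero_at j x)); last first.
  by apply/funext => x; apply: newton_formula.
apply: poly_fun_sum => k; apply: poly_funM; first exact: poly_fun_gbinom.
set g := poly_shift u _; apply: IH; first exact: ltnW.
  move=> i; have [m um] := uk i; have gm : killed g i 1 m by apply: killed_poly_shift.
  have [->|ij] := eqVneq i j.
    exists 1%N; apply/funext => x.
    by rewrite expr1 poly_shift_diff zero_atD1 subrr.
  exists m; move: gm; rewrite /killed -/(diff i) => gm.
  suff -> : forall h, poly_shift (fun x => h (zero_at j x)) (diff i ^+ m) =
      fun x => poly_shift h (diff i ^+ m) (zero_at j x).
    by apply/funext => x; rewrite gm.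
  move=> {gm um}; elim: m => [|m IHm] h; first by rewrite !expr0 !poly_shift1.
  rewrite !exprS !poly_shiftM -IHm; congr poly_shift; apply/funext => x.
  by rewrite !poly_shift_diff zero_atD.
move=> x y xy; rewrite /g !poly_shiftE; apply: eq_bigr => m _; congr (_ * _).
apply: dep => i; rewrite ltnS leq_eqVlt => /predU1P[e|lt].
  have -> : i = j by apply: val_inj.
  by rewrite !mxE eqxx.
by rewrite !mxE; case: eqP => // _; rewrite xy.
Qed.

(** ** The two directions, for exponential polynomials *)

Definition exp_poly q w : seqs := fun x => eval_int q x * exp_freq w x.

Lemma exp_poly_generalized_eigen q w : generalized_eigen (multiplier w) (exp_poly q w).
Proof.
move=> i; have [k qk] := killed_eval_int q i; exists k.
exact/killed_exp_iff.
Qed.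

(** Translations are injective, so the eigenvalues of a nonzero sequence are the
    multipliers of some frequency. *)
Lemma generalized_eigen_exp_poly l h : generalized_eigen l h ->
  exists q w, h = exp_poly q w.
Proof.
move=> hl; have [l0|] := pselect (forall i, l i != 0).
  have [w wl] := exists_multiplier l0.
  pose u : seqs := fun x => h x / exp_freq w x.
  have hE : h = fun x => u x * exp_freq w x.
    by apply/funext => x; rewrite divfK // exp_freq_neq0.
  have [i|q uE] := @newton u.
    have [k] := hl i; rewrite -wl hE => /killed_exp_iff hk.
    by exists k.
  by exists q, w; rewrite hE uE.
move=> /existsNP[i /negP]; rewrite negbK => /eqP li.
exists 0, (const_mx (0, \pi_(torus R)%qT 0)).
have [k] := hl i; rewrite /killed li mpolyC0 subr0 => hk.
have -> : h = 0.
  apply/funext => x; have := congr1 (fun c : seqs => c (x - mnm_vec (U_(i) *+ k)%MM)) hk.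
  by rewrite mpolyXn poly_shiftX /translate subrK.
by apply/funext => x; rewrite /exp_poly /eval_int meval0 mul0r.
Qed.

(** ** A polynomial is determined by its values on the lattice *)

(** Kronecker substitution: along the points with coordinates [t ^ (D ^ i)] the
    polynomial becomes a univariate one, with the same coefficients at distinct
    exponents, which vanishes at all natural numbers [t]. *)
Lemma eval_int_eq0 q : (forall x, eval_int q x = 0) -> q = 0.
Proof.
move=> q0; pose D := msize q; pose ka (m : 'X_{1..s}) := (\sum_(i < s) D ^ i * m i)%N.
pose P : {poly R[i]} := \sum_(m <- msupp q) q@_m *: 'X^(ka m).
have P0 : P = 0.
  apply/eqP/contraT => Pn0; pose rs : seq R[i] := [seq t%:R | t <- iota 0 (size P)].
  have := max_poly_roots Pn0 (rs := rs).
  rewrite size_map size_iota ltnn => -> //; last first.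
    by rewrite map_inj_uniq ?iota_uniq // => t t' /eqP; rewrite eqr_nat => /eqP.
  apply/allP => _ /mapP[t _ ->]; apply/rootP.
  rewrite horner_sum -[RHS](q0 (\row_i (t ^ (D ^ i))%N%:Z)) /eval_int mevalE.
  apply: eq_bigr => m _; rewrite hornerZ hornerXn; congr (_ * _).
  rewrite /ka -prodrXr; apply: eq_bigr => i _.
  by rewrite mxE -pmulrn natrX exprM.
apply/mpolyP => m; rewrite mcoeff0; have [mq|/memN_msupp_eq0 //] := boolP (m \in msupp q).
have := congr1 (fun p : {poly R[i]} => p`_(ka m)) P0; rewrite coef0 coef_sum.
rewrite (bigD1_seq m) //= coefZ coefXn eqxx mulr1 big_seq_cond big1 ?addr0 //.
move=> m' /andP[m'q m'm]; rewrite coefZ coefXn; case: eqP => [e|_]; last by rewrite mulr0.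
case/eqP: m'm; apply/mnmP; apply: (digits_inj (D := D)) => // i.
- by apply: leq_ltn_trans (msize_mdeg_lt m'q); rewrite mdegE (bigD1 i) //= leq_addr.
by apply: leq_ltn_trans (msize_mdeg_lt mq); rewrite mdegE (bigD1 i) //= leq_addr.
Qed.

Lemma exp_poly_inj0 q w : exp_poly q w = 0 -> q = 0.
Proof.
move=> e; apply: eval_int_eq0 => x; have /eqP := congr1 (fun c : seqs => c x) e.
by rewrite mulf_eq0 (negbTE (exp_freq_neq0 _ _)) orbF => /eqP.
Qed.

End Newton.

(** * The space of translates as a sum of exponential polynomials *)

Section ExponentialDecomposition.
Variables (R : realType) (s : nat).
Local Notation seqs := ('rV[int]_s -> R[i]^o).
Local Notation poly := {mpoly R[i][s]}.
Implicit Types (f g h u : seqs) (p q : poly) (x y : 'rV[int]_s) (w : freq R s).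

Definition shift_poly x q : poly := q \mPo [tuple 'X_i + ((x 0 i)%:~R)%:MP | i < s].

Lemma eval_shift_poly x q y : eval_int (shift_poly x q) y = eval_int q (y + x).
Proof.
rewrite /eval_int /shift_poly comp_mpoly_meval; apply: meval_eq => i.
by rewrite tnth_mktuple mevalD mevalXU mevalC mxE intrD.
Qed.

Lemma translate_polyE (a : 'X_{1..s}) q : translate_poly a q = shift_poly (mnm_vec a) q.
Proof.
apply: (congr1 (fun t => q \mPo t)); apply: eq_from_tnth => i.
by rewrite !tnth_mktuple mxE -pmulrn.
Qed.

Lemma exp_polyDZ a p q w : exp_poly (a *: p + q) w = a *: exp_poly p w + exp_poly q w.
Proof.
apply/funext => x; rewrite /exp_poly /eval_int mevalD mevalZ mulrDl -mulrA.
by [].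
Qed.

Lemma exp_poly0 w : exp_poly 0 w = 0.
Proof. by apply/funext => x; rewrite /exp_poly /eval_int meval0 mul0r. Qed.

Lemma exp_polyD p q w : exp_poly (p + q) w = exp_poly p w + exp_poly q w.
Proof. by rewrite -[p]scale1r exp_polyDZ !scale1r. Qed.

Lemma exp_polyZ a p w : exp_poly (a *: p) w = a *: exp_poly p w.
Proof. by rewrite -[a *: p]addr0 exp_polyDZ exp_poly0 addr0. Qed.

Lemma exp_poly_sum (T : Type) (r : seq T) (F : T -> poly) w :
  exp_poly (\sum_(t <- r) F t) w = \sum_(t <- r) exp_poly (F t) w.
Proof.
exact: (big_morph (fun q => exp_poly q w) (fun p q => exp_polyD p q w) (exp_poly0 w)).
Qed.

Lemma translate_exp_poly x q w :
  translate x (exp_poly q w) = exp_poly (exp_freq w x *: shift_poly x q) w.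
Proof.
apply/funext => y; rewrite exp_polyZ /exp_poly /translate.
rewrite [RHS]/(exp_freq w x * (eval_int (shift_poly x q) y * exp_freq w y)).
by rewrite eval_shift_poly exp_freqD [LHS]mulrA [LHS]mulrC.
Qed.

Section Finite.
Variables (f : seqs) (r : nat) (b : 'I_r -> 'rV[int]_s).
Hypothesis inj :
  forall h, shift_space f h -> (forall j, h (b j) = 0) -> h = 0.
Let S := shift_space f.
Let sS : is_subspace S := @shift_space_subspace R s f.

(** The summands stay in the space because they arise from [f] by applying
    polynomials in the translations. *)
Lemma exp_decomposition : exists (Omega : {fset freq R s}) (p : freq R s -> poly),
  (forall w, S (exp_poly (p w) w)) /\ f = \sum_(w <- Omega) exp_poly (p w) w.
Proof.
pose T : set seqs := [set g | exists (Omega : {fset freq R s}) (p : freq R s -> poly),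
  [/\ forall w, S (exp_poly (p w) w), forall w, w \notin Omega -> p w = 0 &
      g = \sum_(w <- Omega) exp_poly (p w) w]].
suff : S `<=` T.
  by move=> /(_ f (shift_space_self f)) [J [p [Sp _ fE]]]; exists J, p.
apply: primary_decomposition => [g q|g i Sg| |g h|l h Sh].
- exact: shift_space_poly.
- by have [u [u0 _ gu]] := exists_univariate_annihilator i inj Sg; exists u.
- exists fset0, (fun=> 0); split=> // [w|]; last by rewrite big_seq_fset0.
  by rewrite exp_poly0; case: sS.
- move=> [J1 [p1 [S1 z1 ->]]] [J2 [p2 [S2 z2 ->]]].
  exists (J1 `|` J2)%fset, (fun w => p1 w + p2 w); split=> [w|w|].
  + by rewrite exp_polyD; apply: subspaceD.
  + by rewrite in_fsetU negb_or => /andP[/z1 -> /z2 ->]; rewrite addr0.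
  rewrite [RHS](eq_bigr (fun w => exp_poly (p1 w) w + exp_poly (p2 w) w)); last first.
    by move=> w _; apply: exp_polyD.
  rewrite big_split /=.
  congr (_ + _); apply: big_fset_incl; rewrite ?fsubsetUl ?fsubsetUr // => w _.
    by move=> /z1 ->; rewrite exp_poly0.
  by move=> /z2 ->; rewrite exp_poly0.
move=> /generalized_eigen_exp_poly[q [w hE]].
exists [fset w]%fset, (fun w' => if w' == w then q else 0); split.
- move=> w'; case: eqP => [->|_]; first by rewrite -hE.
  by rewrite exp_poly0; case: sS.
- by move=> w'; rewrite in_fset1 => /negbTE ->.
by rewrite big_seq_fset1 eqxx.
Qed.

(** The largest coefficient space possible at the frequency [w]. *)
Definition exp_coefs w : set poly := [set q | S (exp_poly q w)].

Lemma exp_coefs_subspace w : is_subspace (exp_coefs w).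
Proof.
split; rewrite /exp_coefs /=; first by rewrite exp_poly0; case: sS.
by move=> a p q Sp Sq; rewrite exp_polyDZ; case: sS => _; apply.
Qed.

Lemma exp_coefs_shift x q w : exp_coefs w q -> exp_coefs w (shift_poly x q).
Proof.
move=> Sq; rewrite /exp_coefs /=.
suff -> : exp_poly (shift_poly x q) w = (exp_freq w x)^-1 *: translate x (exp_poly q w).
  by apply: subspaceZ => //; apply: shift_space_translate.
by rewrite translate_exp_poly exp_polyZ scalerA mulVf ?scale1r ?exp_freq_neq0.
Qed.

Lemma exp_coefs_shift_invariant w : shift_invariant_subspace (exp_coefs w).
Proof.
split; first exact: exp_coefs_subspace.
by move=> a q Sq; rewrite translate_polyE; apply: exp_coefs_shift.
Qed.

Lemma exp_space_subspace w : is_subspace (exp_space (exp_coefs w) w).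
Proof.
have [Q0 QD] := exp_coefs_subspace w; split.
  by exists 0 => //; rewrite -/(exp_poly 0 w) exp_poly0.
move=> a _ _ [p Qp ->] [q Qq ->]; exists (a *: p + q); first exact: QD.
by rewrite -[RHS]/(exp_poly _ w) exp_polyDZ.
Qed.

(** Each translate of [f] decomposes over the frequencies of [f], because
    translation preserves the exponential polynomials of a given frequency. *)
Lemma exp_space_direct_sum (Omega : {fset freq R s}) (p : freq R s -> poly) :
  (forall w, S (exp_poly (p w) w)) -> f = \sum_(w <- Omega) exp_poly (p w) w ->
  is_direct_sum Omega (fun w => exp_space (exp_coefs w) w) S.
Proof.
move=> Sp fE; split; last first.
  move=> u Uu u0; apply: (generalized_eigen_indep (l := @multiplier R s)) u0.
    exact: multiplier_inj.
  by move=> w /Uu[q _ ->]; apply: exp_poly_generalized_eigen.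
apply/seteqP; split; last first.
  move=> _ [u Uu ->]; rewrite big_seq; apply: subspace_sum => // w /Uu[q Sq ->].
  exact: Sq.
apply: lspan_sub.
  split.
    exists (fun=> 0); last by rewrite big1.
    by move=> w _; case: (exp_space_subspace w).
  move=> a _ _ [u Uu ->] [v Vv ->]; exists (fun w => a *: u w + v w).
    by move=> w wO; case: (exp_space_subspace w) => _; apply; [apply: Uu|apply: Vv].
  by rewrite big_split scaler_sumr.
move=> _ [x _ <-]; exists (fun w => translate x (exp_poly (p w) w)).
  move=> w _; rewrite translate_exp_poly.
  exists (exp_freq w x *: shift_poly x (p w)) => //.
  by apply: subspaceZ; [apply: exp_coefs_subspace|apply: exp_coefs_shift; apply: Sp].
by rewrite -translate_sum -fE.
Qed.

(** The values of [exp_poly q w] at the points [b j] embed the coefficient space in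
    a space of dimension [r]. *)
Lemma exp_coefs_basis w : exists n (c : 'I_n -> poly),
  basis_mod (exp_coefs w) [set 0] c.
Proof.
pose e q : 'rV[R[i]]_r := \row_j exp_poly q w (b j).
have elin : linear e.
  move=> a p q; apply/rowP => j; rewrite !mxE exp_polyDZ.
  by [].
pose el := GRing.isLinear.Build R[i] poly 'rV[R[i]]_r *:%R e elin.
pose E : {linear poly -> 'rV[R[i]]_r} := HB.pack e el.
apply: (@exists_basis _ _ _ _ E); first exact: exp_coefs_subspace.
move=> q Sq /rowP qe; apply: (@exp_poly_inj0 _ _ _ w); apply: inj => // j.
by have := qe j; rewrite !mxE.
Qed.

Lemma exp_space_basis w n (c : 'I_n -> poly) :
  basis_mod (exp_coefs w) [set 0] c ->
  basis_mod (exp_space (exp_coefs w) w) [set 0] (fun k => exp_poly (c k) w).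
Proof.
have exp_comb (d : 'I_n -> R[i]) :
    \sum_k d k *: exp_poly (c k) w = exp_poly (\sum_k d k *: c k) w.
  by rewrite exp_poly_sum; apply: eq_bigr => k _; rewrite exp_polyZ.
move=> [Qc ind span]; split=> [k|d|_ [q Qq ->]].
- by exists (c k).
- by rewrite exp_comb => /exp_poly_inj0 /ind.
have [d /eqP] := span q Qq; rewrite subr_eq0 => /eqP qE; exists d.
by rewrite /= exp_comb -qE subrr.
Qed.

Lemma edim_exp_coefs (Omega : {fset freq R s}) :
  is_direct_sum Omega (fun w => exp_space (exp_coefs w) w) S ->
  edim R S = (\sum_(w <- Omega) edim R (exp_coefs w))%E.
Proof.
move=> dS; have /choice[n Hn] := exp_coefs_basis.
pose c w := sval (cid (Hn w)).
have cB w : basis_mod (exp_coefs w) [set 0] (c w) by rewrite /c; case: cid.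
rewrite (edim_direct_sum R exp_space_subspace (fun w => exp_space_basis (cB w)) dS).
apply: eq_bigr => w _; rewrite /edim.
rewrite (edim_quot_basis R (subspace0 _) (cB w)).
exact: (edim_quot_basis R (subspace0 _) (exp_space_basis (cB w))).
Qed.

End Finite.
End ExponentialDecomposition.

(** * The equivalence *)

Theorem theorem2p5 (R : realType) (s : nat) (hs : (1 <= s)%N)
    (f : 'rV[int]_s -> R[i]^o) :
  [<->
    (hankel_rank f < +oo)%E;

    exists (I : set {mpoly R[i][s]}) (G : {fset {mpoly R[i][s]}}),
      [/\ is_ideal I,
          is_groebner_basis I G,
          shift_space f = \bigcap_(q in I) shift_ker q,
          \bigcap_(q in I) shift_ker q = \bigcap_(g in [set` G]) shift_ker g
        & hankel_rank f = edim_quot R [set: {mpoly R[i][s]}] I];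

    exists (Omega : {fset freq R s}) (Q : freq R s -> set {mpoly R[i][s]}),
      [/\ forall w, w \in Omega -> shift_invariant_subspace (Q w),
          is_direct_sum Omega (fun w => exp_space (Q w) w) (shift_space f)
        & hankel_rank f = (\sum_(w <- Omega) edim R (Q w))%E];

    exists (Omega : {fset freq R s}) (Q : freq R s -> set {mpoly R[i][s]}),
      (forall w, w \in Omega -> shift_invariant_subspace (Q w)) /\
      exists2 p : freq R s -> {mpoly R[i][s]},
        (forall w, w \in Omega -> Q w (p w)) &
        forall x, f x = \sum_(w <- Omega) eval_int (p w) x * exp_freq w x ].
Proof.
tfae.
- move=> /hankel_factor[r [a [b [N [rE MN fE]]]]].
  have [G [gG kG]] := annihilator_groebner fE.
  exists (annihilator f), G; split=> //; first exact: annihilator_ideal.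
    exact: shift_space_kernel fE.
  rewrite rE (edim_quot_basis R _ (annihilator_basis MN fE)) //.
  exact: annihilator_subspace.
- move=> [I [G [_ _ SE _ _]]].
  have [r [a [b [N [rE MN fE]]]]] := hankel_factor (kernel_space_finite_rank SE).
  have inj := shift_space_eq0 fE.
  have [J [p [Sp fJ]]] := exp_decomposition inj.
  have dS := exp_space_direct_sum Sp fJ.
  exists J, (exp_coefs f); split=> //.
    by move=> w _; apply: exp_coefs_shift_invariant.
  rewrite -(edim_exp_coefs inj dS) rE.
  by rewrite /edim (edim_quot_basis R (subspace0 _) (shift_space_basis MN fE)).
- move=> [J [Q [Qshift [SE _] _]]]; exists J, Q; split=> //.
  have := shift_space_self f; rewrite SE => -[u Qu fE].
  have /choice[p Hp] : forall w, exists q, w \in J ->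
      Q w q /\ u w = fun x => eval_int q x * exp_freq w x.
    move=> w; have [wJ|nwJ] := boolP (w \in J); last by exists 0.
    by have [q Qq uE] := Qu w wJ; exists q.
  exists p => [w /Hp[]//|x]; rewrite {1}fE fct_sumE big_seq [RHS]big_seq.
  by apply: eq_bigr => w /Hp[_ ->].
move=> [J [Q [_ [p _ fE]]]]; apply: separable_hankel_rank.
have -> : f = \sum_(w <- J) (fun x => eval_int (p w) x * exp_freq w x).
  by apply/funext => x; rewrite fE fct_sumE.
by apply: separable_sum => w; apply: separable_exp_poly.
Qed.
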